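(* For $n=4,8,12,16$ and $20$, every maximal triply even code of length $2n$ is equivalent to $\tilde{\mathcal{D}}(C)$ for some maximal doubly even code $C$ of length $n$.
   Context: A code of length $n$ is a linear subspace of $\mathbb{F}_2^n$. For $u\in\mathbb{F}_2^n$, $\operatorname{supp}(u)$ is the set of coordinates where $u$ is $1$ and $\operatorname{wt}(u)=|\operatorname{supp}(u)|$. A code is doubly even (resp. triply even) if every codeword has weight divisible by $4$ (resp. $8$). A doubly even (resp. triply even) code is maximal if it is not contained in any larger doubly even (resp. triply even) code of the same length. Two codes of length $n$ are equivalent if one is obtained from the other by a permutation of the coordinates. $C^\perp$ is the dual with respect to the standard inner product. For $u,v\in\mathbb{F}_2^n$, $u\ast v$ is the vector with support $\operatorname{supp}(u)\cap\operatorname{supp}(v)$. $\mathbf 0_n$ is the zero vector, and $(u|v)$ denotes concatenation. For a doubly even code $C$ of length $n$ define $B:C\times C^\perp\to\mathbb{F}_2$, $B(v,u)=\frac{\operatorname{wt}(v\ast u)}{2}\bmod 2$; $\operatorname{rad}C=\{y\in C^\perp\mid B(x,y)=0\ \text{for all } x\in C\}$; $\operatorname{Rad}C=\{x\in\operatorname{rad}C\mid \operatorname{wt}(x)\equiv0\pmod 8\}$. The generalized doubling of $C$ is the code of length $2n$ $$\tilde{\mathcal{D}}(C)=\langle \{(r|\mathbf 0_n)\mid r\in C\cap\operatorname{Rad}C\}\cup\{(x|x)\mid x\in C\}\rangle.$$ *)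

(* Defs.v *)
From HB Require Import structures.
From mathcomp Require Import all_boot all_order all_fingroup all_algebra.
Set Implicit Arguments.
Unset Strict Implicit.
Unset Printing Implicit Defensive.
Import GRing.Theory.
Local Open Scope ring_scope.

Notation word n := 'rV['F_2]_n.
Notation code n := {vspace word n}.

Definition supp n (u : word n) : {set 'I_n} := [set i | u 0 i == 1].

Definition wt n (u : word n) : nat := #|supp u|.

Definition star n (u v : word n) : word n :=
  \row_i (i \in supp u :&: supp v)%:R.

Definition doubly_even n (C : code n) : Prop :=
  forall x, x \in C -> (4 %| wt x)%N.

Definition triply_even n (C : code n) : Prop :=
  forall x, x \in C -> (8 %| wt x)%N.

Definition maximal_doubly_even n (C : code n) : Prop :=
  doubly_even C /\
  forall D : code n, doubly_even D -> (C <= D)%VS -> D = C.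

Definition maximal_triply_even n (C : code n) : Prop :=
  triply_even C /\
  forall D : code n, triply_even D -> (C <= D)%VS -> D = C.

Definition code_equiv n (C D : code n) : Prop :=
  exists s : 'S_n, [set y in D] = [set col_perm s x | x in C].

Definition dualC n (C : code n) : {set word n} :=
  [set u : word n | [forall v : word n in C, \sum_i u 0 i * v 0 i == 0]].

(* Intended for v \in C and u \in dualC C, where wt (star v u) is even and the
   division by 2 is exact. *)
Definition B n (v u : word n) : 'F_2 := (wt (star v u) %/ 2)%:R.

(* radC C need not be a linear subspace (B is not bilinear in general), so it
   and RadC C are plain sets. *)
Definition radC n (C : code n) : {set word n} :=
  [set y in dualC C | [forall x : word n in C, B x y == 0]].

Definition RadC n (C : code n) : {set word n} :=
  [set x in radC C | 8 %| wt x]%N.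

(* Length 2n is rendered as n + n, so that (u|v) is row_mx u v. *)
Definition gen_doubling n (C : code n) : code (n + n) :=
  <<[seq row_mx r 0 | r in [pred r in C | r \in RadC C]]
    ++ [seq row_mx x x | x in C]>>%VS.

(* Main.v *)
Require Import Defs.
From HB Require Import structures.
From mathcomp Require Import all_boot all_order all_fingroup all_algebra.
From mathcomp Require Import zify.

(** A triply even code is the multiset [m] of the columns of a generator matrix,
    points of a binary vector space [V]; that all weights are divisible by [8] is
    a condition on the Fourier transform of [m].  A generalized doubling is
    recognized on [m]: its columns come in pairs [h, h + v] whose differences [v]
    are constant on blocks, and the halves [h] of each block carry a doubly even
    code, of length divisible by [8] if [v <> 0] ([paired]).  Given such a pairing
    one enlarges the code of the halves, block by block, to a maximal doubly even
    code [C].  The blocks with [v <> 0] become self-dual codes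
    ([maximal_self_dual]), which makes [C] maximal among all doubly even codes
    ([blockwise_maximal]), and their all-one words lie in [Rad C].  So a
    permutation maps the given code into the doubling of [C], which is triply
    even, and a maximal code fills it.

    It remains to pair the columns when there are at most [40] of them
    ([divisible_paired]).  Columns of even multiplicity are paired with [v = 0], so
    the obstruction is the set [S] of columns of odd multiplicity.  Its
    characteristic function is orthogonal to all cubic polynomials; hence, as for
    the small weights of Reed-Muller codes, [S] has [0], [16], [24] or at least
    [28] points, and is an affine flat if it has [16] ([oddset_div8],
    [oddset16_flat]).  A flat of size [16] is invariant under translations and can
    be split off, and so can [8] copies of one column.  This reduces everything to
    finding such a part.

    - In lengths [24] and [40] every Fourier coefficient is [8] modulo [16], so its
      square is at least [64].  Hence the autocorrelation of [m] at [v <> 0] is at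
      most its value at [0] minus [64]: repeated columns are forced, and only a
      column of multiplicity [8] is compatible with the few repetitions that a
      large [S] leaves room for ([heavy24], [heavy40]).  The case [#|S| = 24] needs
      moments up to order [4] ([light40]).
    - In length [32] the coefficients are [0], [+-16] and [+-32].  Either a
      translation fixes [m], or the characters with coefficient [+-16] separate
      the columns; these are the words of weight [8] and [24], each of which cuts
      out [8] of the columns.  Such a set of [8] columns is a flat if it meets [S],
      and four of them fill a flat of size [16] up to one point, which a reduction
      to length [24] provides ([length32]). *)

Set Implicit Arguments.
Unset Strict Implicit.
Unset Printing Implicit Defensive.
Import Order.TTheory GRing.Theory Num.Theory.
Local Open Scope ring_scope.

(** * Characters of a binary vector space *)

Definition dot d (x p : word d) : 'F_2 := \sum_i x 0 i * p 0 i.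

Definition chi d (x p : word d) : int := if dot x p == 0 then 1 else -1.

Lemma F2P (a : 'F_2) : a = 0 \/ a = 1.
Proof. by case: a => [[|[|//]] i]; [left|right]; apply/val_inj. Qed.

Lemma F2_neq0 (a : 'F_2) : (a != 0) = (a == 1).
Proof. by case: (F2P a) => ->. Qed.

Lemma F2_addrr (a : 'F_2) : a + a = 0.
Proof. by case: (F2P a) => ->; apply/val_inj. Qed.

Section Chi.
Variable d : nat.
Implicit Types (x y p q v : word d).

Lemma addww p : p + p = 0.
Proof. by apply/rowP=> i; rewrite !mxE F2_addrr. Qed.

Lemma oppw p : - p = p.
Proof. by apply/eqP; rewrite eq_sym -addr_eq0 addww. Qed.

Lemma addKw p q : p + (p + q) = q.
Proof. by rewrite addrA addww add0r. Qed.

Lemma addwK p q : q + p + p = q.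
Proof. by rewrite -addrA addww addr0. Qed.

Lemma addw_eq0 p q : (p + q == 0) = (p == q).
Proof. by rewrite addr_eq0 oppw. Qed.

Lemma addw_neq p v : v != 0 -> p + v != p.
Proof. by apply: contraNneq => e; rewrite -(addKw p v) e addww. Qed.

Lemma addw_inj v : injective (fun p => p + v).
Proof. exact: addIr. Qed.

Lemma dotC x p : dot x p = dot p x.
Proof. by apply: eq_bigr => i _; rewrite mulrC. Qed.

Lemma dotDr x p q : dot x (p + q) = dot x p + dot x q.
Proof. by rewrite -big_split; apply: eq_bigr => i _; rewrite mxE mulrDr. Qed.

Lemma dotDl x y p : dot (x + y) p = dot x p + dot y p.
Proof. by rewrite dotC dotDr !(dotC p). Qed.

Lemma dot0r x : dot x 0 = 0.
Proof. by rewrite /dot big1 // => i _; rewrite mxE mulr0. Qed.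

Lemma chiC x p : chi x p = chi p x.
Proof. by rewrite /chi dotC. Qed.

Lemma chiD x p q : chi x (p + q) = chi x p * chi x q.
Proof.
by rewrite /chi dotDr; case: (F2P (dot x p)) (F2P (dot x q)) => -> [] ->.
Qed.

Lemma chiDl x y p : chi (x + y) p = chi x p * chi y p.
Proof. by rewrite chiC chiD !(chiC p). Qed.

Lemma chi0 x : chi x 0 = 1.
Proof. by rewrite /chi dot0r. Qed.

Lemma chiP x p : chi x p = 1 \/ chi x p = -1.
Proof. by rewrite /chi; case: ifP; [left|right]. Qed.

Lemma chi_sq x p : chi x p * chi x p = 1.
Proof. by rewrite -chiD addww chi0. Qed.

Lemma chiE x p : chi x p = 1 - 2 * (dot x p == 1)%:R.
Proof. by rewrite /chi -F2_neq0; case: eqP. Qed.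

Lemma dot_eq1 x p : (dot x p == 1) = (chi x p == -1).
Proof. by rewrite /chi -F2_neq0; case: eqP. Qed.

Lemma dot_nondegenerate v : v != 0 -> exists y, dot y v = 1.
Proof.
move=> v0; have [i vi] : exists i, v 0 i != 0.
  apply/existsP; apply: contraNT v0; rewrite negb_exists => /forallP H.
  by apply/eqP/rowP=> i; rewrite mxE; have /negPn/eqP := H i.
exists (delta_mx 0 i); rewrite /dot (bigD1 i) //= big1 ?addr0.
  by rewrite mxE !eqxx mul1r; case: (F2P (v 0 i)) vi => ->.
by move=> j ji; rewrite mxE eqxx (negPf ji) mul0r.
Qed.

Definition ordV : int := #|{: word d}|%:Z.

Lemma ordV_gt0 : 0 < ordV.
Proof. by rewrite /ordV ltz_nat; apply/card_gt0P; exists 0. Qed.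

Lemma card_word : #|{: word d}| = (2 ^ d)%N.
Proof. by rewrite card_mx card_Fp // mul1n. Qed.

Lemma sum_shift (R : nmodType) (f : word d -> R) v :
  \sum_p f (p + v) = \sum_p f p.
Proof. by rewrite [RHS](reindex_inj (@addw_inj v)). Qed.

Lemma sum_chi p : \sum_x chi x p = if p == 0 then ordV else 0.
Proof.
case: eqP => [->|/eqP/dot_nondegenerate[y yp]].
  under eq_bigr do rewrite chi0.
  by rewrite sumr_const /ordV pmulrn mulrzz mul1r.
suff : \sum_x chi x p = - \sum_x chi x p by lia.
rewrite -{1}(sum_shift _ y) -sumrN; apply: eq_bigr => x _.
by rewrite chiDl {2}/chi yp /= mulrN1.
Qed.

(** As [- p = p], the convolution involves no sign. *)
Definition ft (f : word d -> int) x : int := \sum_p f p * chi x p.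

Definition conv (f g : word d -> int) v : int := \sum_p f p * g (p + v).

Lemma ft_inv f q : \sum_x ft f x * chi x q = ordV * f q.
Proof.
under eq_bigr do rewrite mulr_suml.
rewrite exchange_big /= (bigD1 q) //= [X in _ + X]big1 ?addr0.
  under eq_bigr do rewrite -mulrA chi_sq mulr1.
  by rewrite sumr_const pmulrn mulrzz mulrC.
move=> p pq; under eq_bigr do rewrite -mulrA -chiD.
by rewrite -mulr_sumr sum_chi addw_eq0 (negPf pq) mulr0.
Qed.

Lemma ft_conv f g x : ft (conv f g) x = ft f x * ft g x.
Proof.
rewrite /ft mulr_suml.
under eq_bigr do rewrite /conv mulr_suml.
rewrite exchange_big; apply: eq_bigr => p _ /=.
rewrite -(sum_shift _ p) mulr_sumr; apply: eq_bigr => q _.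
by rewrite (addrC p) addwK chiD; lia.
Qed.

Lemma parseval f g v :
  \sum_x ft f x * ft g x * chi x v = ordV * conv f g v.
Proof. by rewrite -ft_inv; apply: eq_bigr => x _; rewrite ft_conv. Qed.

Lemma conv0 f g : conv f g 0 = \sum_p f p * g p.
Proof. by apply: eq_bigr => p _; rewrite addr0. Qed.

Lemma ft0 f : ft f 0 = \sum_p f p.
Proof. by apply: eq_bigr => p _; rewrite chiC chi0 mulr1. Qed.

End Chi.

(** * Divisible multisets and the size of their odd part *)

(** The weight of the codeword [x *m A], where [m] counts the columns of [A]. *)
Definition wtm d (m : word d -> nat) x : nat := (\sum_(p | dot x p == 1%R) m p)%N.
Definition total d (m : word d -> nat) : nat := (\sum_p m p)%N.
Definition divisible e d (m : word d -> nat) := forall x, (e %| wtm m x)%N.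
Definition oddset d (m : word d -> nat) : {set word d} := [set p | odd (m p)].
Definition ftm d (m : word d -> nat) := ft (fun p => (m p)%:Z).

Definition selfdiff d (A : {set word d}) v : nat := #|[set p in A | p + v \in A]|.

Section Multiset.
Variable d : nat.
Implicit Types (m : word d -> nat) (A : {set word d}) (x p q v : word d).

Lemma PoszE m (P : pred (word d)) :
  (\sum_(p | P p) m p)%N%:Z = \sum_(p | P p) (m p)%:Z.
Proof. by elim/big_rec2: _ => // i y1 y2 _ <-; rewrite PoszD. Qed.

Lemma ftmE m x : ftm m x = (total m)%:Z - 2 * (wtm m x)%:Z.
Proof.
rewrite /ftm /ft /total /wtm !PoszE [X in 2 * X]big_mkcond mulr_sumr -sumrB.
by apply: eq_bigr => p _ /=; rewrite chiE; case: eqP => _ /=; lia.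
Qed.

Lemma ftm_le m x : `|ftm m x| <= (total m)%:Z.
Proof.
have H : (wtm m x <= total m)%N.
  by rewrite /wtm /total [leqLHS]big_mkcond; apply: leq_sum => p _; case: ifP.
by rewrite ftmE; lia.
Qed.

Lemma odd_sum_card (P : pred (word d)) m :
  odd (\sum_(p | P p) m p)%N = odd (\sum_(p | P p) odd (m p))%N.
Proof.
by elim/big_rec2: _ => // i y1 y2 _ /= H; rewrite !oddD H; case: (odd (m i)).
Qed.

Lemma card_oddset m : #|oddset m| = (\sum_p odd (m p))%N.
Proof. by rewrite -sum1dep_card big_mkcond; apply: eq_bigr => p _; case: odd. Qed.

Lemma odd_total m : odd (total m) = odd #|oddset m|.
Proof. by rewrite card_oddset /total odd_sum_card. Qed.

Lemma selfdiffE A v :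
  (selfdiff A v)%:Z = conv (fun p => (p \in A)%:R) (fun p => (p \in A)%:R) v.
Proof.
rewrite /selfdiff -sum1dep_card PoszE big_mkcond /=; apply: eq_bigr => p _.
by case: (p \in A); case: (p + v \in A).
Qed.

Lemma selfdiff0 A : selfdiff A 0 = #|A|.
Proof. by rewrite /selfdiff; apply: eq_card => p; rewrite inE addr0 andbb. Qed.

Lemma selfdiff_full A v p : selfdiff A v = #|A| -> p \in A -> p + v \in A.
Proof.
move=> e pA; have /eqP H : [set p in A | p + v \in A] == A.
  by rewrite eqEcard -[X in (_ <= X)%N]/(selfdiff A v) e leqnn andbT;
     apply/subsetP=> q; rewrite inE => /andP[].
by move: pA; rewrite -{1}H inE => /andP[].
Qed.

Lemma full_selfdiff A v : (forall p, p \in A -> p + v \in A) ->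
  selfdiff A v = #|A|.
Proof.
move=> H; apply: eq_card => p; rewrite inE.
by apply/andP/idP => [[]//|pA]; rewrite H.
Qed.

Lemma sum_selfdiff A :
  (\sum_(v : word d | v != 0%R) selfdiff A v = #|A| * (#|A|.-1))%N.
Proof.
suff : (\sum_v selfdiff A v = #|A| * #|A|)%N.
  rewrite (bigD1 0%R) //= selfdiff0; move: (bigop _ _ _) #|A| => S k; case: k => [|k] /=; nia.
rewrite /selfdiff.
under eq_bigr do rewrite -sum1dep_card big_mkcondr.
rewrite exchange_big /=; have -> : (#|A| * #|A| = \sum_(p in A) #|A|)%N.
  by rewrite sum_nat_const.
apply: eq_bigr => p _; rewrite -sum1_card [RHS]big_mkcond /=.
by rewrite -[RHS](sum_shift _ p); apply: eq_bigr => v _; rewrite addrC.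
Qed.

Lemma card_nonzero : #|[pred v : word d | v != 0%R]| = #|{: word d}|.-1.
Proof. by rewrite -(cardC1 0%R); apply: eq_card => v. Qed.

(** The translation exchanges the two halves cut out by a hyperplane. *)
Lemma even_invariant A v :
  v != 0 -> (forall p, p \in A -> p + v \in A) -> ~~ odd #|A|.
Proof.
move=> /dot_nondegenerate[y yv] Av.
have vA p : (p + v \in A) = (p \in A).
  by apply/idP/idP => [/Av|/Av//]; rewrite addwK.
rewrite -sum1_card (bigID (fun p => dot y p == 0%R)) /=.
rewrite [X in (_ + X)%N](_ : _ = \sum_(p in A | dot y p == 0%R) 1)%N.
  by rewrite addnn odd_double.
rewrite [RHS](reindex_inj (@addw_inj d v)) /=; apply: eq_bigl => p.
by rewrite vA dotDr yv; case: (F2P (dot y p)) => ->.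
Qed.

(** By Fourier inversion the order of the group times [m q] is twice an integral
    combination of the weights.  The zero column is seen by no codeword. *)
Lemma divisible_even e m q : (#|{: word d}| %| e)%N -> divisible e m ->
  q != 0 -> ~~ odd (m q).
Proof.
move=> De dm q0.
have H : ordV d * (m q)%:Z = - (2 * \sum_x (wtm m x)%:Z * chi x q).
  rewrite -(ft_inv (fun p => (m p)%:Z)) mulr_sumr -sumrN.
  under eq_bigr => x _ do rewrite -/(ftm m x) ftmE mulrBl.
  rewrite sumrB -mulr_sumr sum_chi (negPf q0) mulr0 sub0r -sumrN.
  by apply: eq_bigr => x _; lia.
have [c Hc] : exists c : int, \sum_x (wtm m x)%:Z * chi x q = ordV d * c.
  apply: (big_ind (fun s => exists c, s = ordV d * c)).
  - by exists 0; rewrite mulr0.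
  - by move=> _ _ [a ->] [b ->]; exists (a + b); rewrite mulrDr.
  move=> x _; have /dvdnP[k ->] := dvdn_trans De (dm x).
  by exists (k%:Z * chi x q); rewrite /ordV; lia.
have D0 := ordV_gt0 d; have : (m q)%:Z = - (2 * c) by nia.
lia.
Qed.

End Multiset.

(** ** Projection along a direction *)

Section Push.
Variables (d d' : nat) (A : 'M['F_2]_(d, d')) (m : word d -> nat).

Definition push (y : word d') : nat := (\sum_(p | (p *m A)%R == y) m p)%N.

Lemma push_sum (P : pred (word d')) :
  (\sum_(y | P y) push y = \sum_(p | P (p *m A)%R) m p)%N.
Proof.
rewrite /push [RHS](partition_big (fun p => p *m A) P) //=.
apply: eq_bigr => y Py; apply: eq_bigl => p.
by case: eqP => [->|]; rewrite ?Py ?andbF.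
Qed.

Lemma dot_mulmx x (p : word d) : dot x (p *m A) = dot (x *m A^T) p.
Proof.
have E n (u w : word n) : dot u w = (u *m w^T) 0 0.
  by rewrite mxE; apply: eq_bigr => i _; rewrite mxE.
by rewrite !E trmx_mul -mulmxA.
Qed.

Lemma push_divisible e : divisible e m -> divisible e push.
Proof.
move=> dm x; rewrite /wtm push_sum.
by under eq_bigl do rewrite dot_mulmx; apply: dm.
Qed.

Lemma push_total : total push = total m.
Proof. exact: (push_sum xpredT). Qed.

End Push.

(** Identifying the columns [p] and [p + v] cancels the pairs of odd columns
    with difference [v]. *)
Lemma push_oddset d (m : word d -> nat) (v : word d) : v != 0 ->
  exists d' (A : 'M['F_2]_(d, d')), (d' < d)%N /\
    (#|oddset (push A m)| + selfdiff (oddset m) v = #|oddset m|)%N.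
Proof.
move=> v0; exists (\rank (cokermx v)), (col_base (cokermx v)).
set A := col_base _.
have kerA p q : (p *m A == q *m A) = (p == q) || (p == q + v).
  have E r : (r *m A == 0) = (r <= v)%MS.
    rewrite submxE -[X in _ = (_ *m X == _)](mulmx_base (cokermx v)) mulmxA.
    apply/eqP/eqP => [->|]; first by rewrite mul0mx.
    move=> e; apply: (row_free_inj (row_base_free (cokermx v))).
    by rewrite /= e mul0mx.
  rewrite -subr_eq0 -mulmxBl E oppw; apply/sub_rVP/orP => [[a]|].
    case: (F2P a) => ->; rewrite ?scale0r ?scale1r.
      by move/eqP; rewrite addw_eq0; left.
    by move=> <-; right; rewrite (addrC p) addKw.
  case=> /eqP->; first by exists 0; rewrite scale0r addww.
  by exists 1; rewrite scale1r (addrC q) addwK.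
have kerm (p : word d) : #|[set q | q *m A == p *m A]| = 2%N.
  rewrite (_ : [set _ | _] = [set p; p + v]).
    by rewrite cards2 eq_sym addw_neq.
  by apply/setP=> q; rewrite !inE kerA.
have d0 : (0 < d)%N.
  rewrite lt0n; apply: contraNneq v0 => d0; apply/eqP/rowP=> i.
  by have := ltn_ord i; rewrite {2}d0.
split; first by rewrite mxrank_coker rank_rV v0 ltn_subrL d0.
have pushE (p : word d) : push A m (p *m A) = (m p + m (p + v)%R)%N.
  rewrite /push (bigD1 p) //= (bigD1 (p + v)) /=; last by rewrite kerA eqxx orbT addw_neq.
  rewrite big1 ?addn0 // => q; rewrite kerA => /andP[/andP[/orP[]/eqP-> ]];
  by rewrite eqxx.
have two : (\sum_p odd (push A m (p *m A)%R) = 2 * #|oddset (push A m)|)%N.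
  rewrite card_oddset big_distrr /= (partition_big (fun p => p *m A) xpredT) //=.
  apply: eq_bigr => y _.
  have -> : (\sum_(p | (p *m A)%R == y) odd (push A m (p *m A)%R) =
             \sum_(p | (p *m A)%R == y) odd (push A m y))%N.
    by apply: eq_bigr => p /eqP->.
  case o : (odd _); last by rewrite big1.
  have [p py] : exists p, p *m A == y.
    apply/existsP; apply: contraTT o; rewrite negb_exists => /forallP H.
    by rewrite /push big_pred0 // => p; apply: negbTE.
  by rewrite sum1dep_card -(eqP py) kerm.
suff : (2 * #|oddset (push A m)| + 2 * selfdiff (oddset m) v = 2 * #|oddset m|)%N.
  by lia.
have S1 : (#|oddset m| = \sum_p odd (m (p + v)%R))%N.
  by rewrite card_oddset (sum_shift (fun p => nat_of_bool (odd (m p)))).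
rewrite -two [RHS]mul2n -addnn {1}card_oddset S1 -big_split /selfdiff -sum1dep_card.
rewrite [X in (2 * X)%N]big_mkcond big_distrr -big_split; apply: eq_bigr => p _ /=.
by rewrite pushE oddD !inE; case: (odd _); case: (odd _).
Qed.

(** The difference counts add up to [#|A| * (#|A| - 1)]. *)
Lemma selfdiff_mod d (A : {set word d}) r q :
  (forall v, v != 0 -> selfdiff A v = r %[mod q]) ->
  (#|A| * (#|A|.-1) = r * (2 ^ d).-1 %[mod q])%N.
Proof.
move=> H; rewrite -sum_selfdiff.
have -> : ((2 ^ d).-1 = #|[pred v : word d | v != 0%R]|)%N.
  by rewrite card_nonzero card_word.
rewrite mulnC -sum_nat_const.
apply: (big_ind2 (fun a b => a = b %[mod q])) => // a b a' b' e e'.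
by rewrite -modnDm e e' modnDm.
Qed.

Section OddPart.

Variables (d : nat) (m : word d -> nat) (e : nat).
Hypotheses (dm : divisible e m) (em : ~~ odd (total m)).
Let S := oddset m.

(** Such a set [S] is the whole space, of dimension bounded by the first
    hypothesis, and [divisible_even] applies. *)
Lemma invariant_oddset : (forall k, #|S| = 2 ^ k -> 2 ^ k %| e)%N ->
  (forall v, v != 0 -> selfdiff S v = #|S|) -> #|S| = 0%N.
Proof.
move=> pe inv; apply/eqP; apply: contraNT em => S0.
have D : #|S| = #|{: word d}|.
  have := sum_selfdiff S; rewrite (eq_bigr (fun _ => #|S|)) //.
  rewrite sum_nat_const card_nonzero mulnC => /eqP; rewrite eqn_mul2l (negPf S0) /=.
  move/eqP=> E; have V0 : (0 < #|{: word d}|)%N by apply/card_gt0P; exists 0.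
  by rewrite -(prednK V0) E prednK // lt0n.
have De : (#|{: word d}| %| e)%N.
  by rewrite card_word pe // D card_word.
have S1 : S = [set 0].
  apply/eqP; rewrite eqEcard cards1 lt0n S0 andbT; apply/subsetP=> q.
  rewrite !inE; apply: contraLR; exact: (divisible_even De dm).
by rewrite odd_total -/S S1 cards1.
Qed.

Lemma even_oddset : ~~ odd #|S|.
Proof. by rewrite -odd_total. Qed.

End OddPart.

Lemma oddset_step (P : nat -> Prop) e d (m : word d -> nat) :
  (forall d', (d' < d)%N -> forall m' : word d' -> nat,
    divisible e m' -> ~~ odd (total m') -> P #|oddset m'|) ->
  divisible e m -> ~~ odd (total m) ->
  forall v : word d, v != 0 -> exists2 s,
    P s & (s + selfdiff (oddset m) v = #|oddset m|)%N.
Proof.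
move=> IH dm em v v0; have [d' [A [lt_d' s_eq]]] := push_oddset m v0.
exists #|oddset (push A m)| => //; apply: IH => //; first exact: push_divisible.
by rewrite push_total.
Qed.

Lemma card_oddset_le d (m : word d -> nat) : (#|oddset m| <= 2 ^ d)%N.
Proof. by rewrite -card_word max_card. Qed.

(** The sizes below [14] and [28] of the sets orthogonal to the polynomials of
    degree at most [2] and [3] respectively, which are supports of words of
    Reed-Muller codes of minimum distance [8] and [16]. *)
Definition size4 s := [\/ s = 0, s = 8, s = 12 | 14 <= s]%N.
Definition size8 s := [\/ s = 0, s = 16, s = 24 | 28 <= s]%N.

Lemma dim_gt d (m : word d -> nat) k : (2 ^ k < #|oddset m|)%N -> (k < d)%N.
Proof.
move=> h; rewrite ltnNge; apply/negP => /(leq_pexp2l (isT : 0 < 2)%N).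
by rewrite leqNgt (leq_trans h) ?card_oddset_le.
Qed.

(** Induction on the dimension: the difference counts of the odd part [S] are
    [#|S| - s'] with [s'] the size of the odd part of a projection, and they add
    up to [#|S| * (#|S| - 1)], which excludes the other small sizes. *)
Lemma oddset_div4 d (m : word d -> nat) :
  divisible 4 m -> ~~ odd (total m) -> size4 #|oddset m|.
Proof.
elim/ltn_ind: d m => d IH m dm em; have step := oddset_step IH dm em.
have s2 := even_oddset em.
have := @invariant_oddset _ _ _ dm em; have := @selfdiff_mod _ (oddset m) 2 8.
have := @dim_gt _ m 3; move: #|oddset m| step s2 => s step s2 dim_gt md inv.
case: (leqP 14 s) => s14; first by constructor 4.
case: (ltngtP s 8) => [s8|s8|]; last by constructor 2.
  constructor 1; apply: inv => [k sk|v /step[s']]; last by case; lia.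
  by case: k sk => [|[|[|k]]] // sk; move: s8; rewrite sk !expnS; lia.
case: (eqVneq s 12%N) => [|s12]; first by constructor 3.
have s10 : s = 10%N by lia.
have d4 : (3 < d)%N by rewrite dim_gt ?s10.
have H v : v != 0 -> selfdiff (oddset m) v = 2 %[mod 8].
  by move/step=> [s' h E]; move: (selfdiff _ _) E => N E; case: h => ?; lia.
move: (md H); rewrite s10 -(subnKC d4) expnD.
have : (0 < 2 ^ (d - 4))%N by rewrite expn_gt0.
by move: (2 ^ (d - 4))%N => k; lia.
Qed.

(** The same induction as for [oddset_div4]. *)
Lemma oddset_div8 d (m : word d -> nat) :
  divisible 8 m -> ~~ odd (total m) -> size8 #|oddset m|.
Proof.
elim/ltn_ind: d m => d IH m dm em; have step := oddset_step IH dm em.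
have s2 := even_oddset em.
have := @invariant_oddset _ _ _ dm em; have modS := @selfdiff_mod _ (oddset m).
have := @dim_gt _ m 4.
have := sum_selfdiff (oddset m).
have full v : selfdiff (oddset m) v = #|oddset m| <->
    forall q, q \in oddset m -> q + v \in oddset m.
  by split=> [/selfdiff_full//|/full_selfdiff].
move: #|oddset m| step s2 modS full => s step s2 modS full sumS dim_gt inv.
case: (leqP 28 s) => s28; first by constructor 4.
case: (ltngtP s 16) => [s16|s16|]; last by constructor 2.
  constructor 1; apply: inv => [k sk|v /step[s']]; last by case; lia.
  by case: k sk => [|[|[|[|k]]]] // sk; move: s16; rewrite sk !expnS; lia.
case: (eqVneq s 24%N) => [|s24]; first by constructor 3.
have d5 : (4 < d)%N by rewrite dim_gt.
have k0 : (0 < 2 ^ (d - 5))%N by rewrite expn_gt0.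
have dE : (2 ^ d = 32 * 2 ^ (d - 5))%N by rewrite -(expnD 2 5) subnKC.
exfalso; case: (eqVneq s 20%N) => [s20|s20]; last first.
  have H v : v != 0 ->
      selfdiff (oddset m) v = (if s == 26 then 2 else s - 16)%N
        %[mod (if s == 26 then 8 else 16)%N].
    move/step=> [s' H E]; move: (selfdiff _ _) E => N E.
    by case: eqP => ?; case: H => ?; lia.
  move: (modS _ _ H) => {H modS step sumS}; rewrite dE.
  move: (2 ^ _)%N k0 => k k0; case: eqP => [->|s26]; first by lia.
  have [->|->] : s = 18%N \/ s = 22%N by lia.
    by lia.
  by lia.
(* Here each difference count is 20 or 4.  The counts equal to 20 belong to a
   group of translations, and their number turns out to be of the wrong parity. *)
pose I := [set v | (v == 0) || (selfdiff (oddset m) v == 20%N)].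
have cI : (4 * (2 ^ d).-1 + 16 * (#|I|).-1 = 380)%N.
  have := sumS; rewrite s20 -[(20 * 20.-1)%N]/380%N => <-.
  have -> : #|I|.-1 = (\sum_(v : word d | v != 0%R) (selfdiff (oddset m) v == 20%N))%N.
    rewrite (cardsD1 0%R) inE eqxx add1n /= -sum1_card -big_mkcondr /=.
    by apply: eq_bigl => v; rewrite !inE; case: eqP.
  have -> : (2 ^ d).-1 = (\sum_(v : word d | v != 0%R) 1)%N.
    by rewrite sum1_card card_nonzero card_word.
  rewrite !big_distrr -big_split; apply: eq_bigr => v /step[s' H E] /=.
  by move: (selfdiff _ _) E => N E; case: eqP; case: H => ?; lia.
have I0 : (0 < #|I|)%N by apply/card_gt0P; exists 0; rewrite inE eqxx.
have Iodd : odd #|I| /\ (#|I| > 1)%N.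
  move: cI I0; rewrite dE; move: #|I| => c.
  have : (d - 5 < 2)%N \/ (4 <= 2 ^ (d - 5))%N.
    by case: (ltnP (d - 5) 2) => h; [left|right; rewrite (@leq_pexp2l 2 2)].
  by case=> [|h]; last lia; case: (d - 5)%N => [|[|//]] _ /=; lia.
have [v vI v0] : exists2 v, v \in I & v != 0.
  case: Iodd => _ /card_gt1P[a [b [aI bI ab]]].
  by case: (eqVneq a 0) ab => [->|a0 _]; [exists b; rewrite // eq_sym | exists a].
suff : ~~ odd #|I| by case: Iodd => ->.
have inI p : p \in I -> forall q, q \in oddset m -> q + p \in oddset m.
  rewrite inE => /orP[/eqP-> q|/eqP E q qS]; first by rewrite addr0.
  by move: q qS; apply/full; rewrite E s20.
apply: (even_invariant v0) => p pI.
rewrite inE; apply/orP; right.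
by rewrite -s20; apply/eqP/full => q qS; rewrite addrA; apply: (inI _ vI); apply: (inI _ pI).
Qed.

(** * Flats, sections and repeated columns *)

Definition ind d (A : {set word d}) (p : word d) : nat := p \in A.
Definition flat d (A : {set word d}) :=
  forall p q r, p \in A -> q \in A -> r \in A -> p + q + r \in A.

Section Basics.
Variable d : nat.
Implicit Types (m : word d -> nat) (A : {set word d}) (x p q v : word d).

Lemma wtm_ind A x : wtm (ind A) x = #|[set p in A | dot x p == 1]|.
Proof.
rewrite /wtm -sum1dep_card big_mkcond [RHS]big_mkcond.
by apply: eq_bigr => p _; rewrite /ind; case: (p \in A); case: eqP.
Qed.

Lemma total_ind A : total (ind A) = #|A|.
Proof.
rewrite /total -sum1_card [RHS]big_mkcond.
by apply: eq_bigr => p _; rewrite /ind; case: (p \in A).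
Qed.

Lemma divisible_add e m m' : divisible e m -> divisible e m' ->
  divisible e (fun p => m p + m' p)%N.
Proof. by move=> H H' x; rewrite /wtm big_split; apply: dvdn_add; [apply: H | apply: H']. Qed.

Lemma total_add m m' : total (fun p => m p + m' p)%N = (total m + total m')%N.
Proof. exact: big_split. Qed.

Lemma eq_total m m' : m =1 m' -> total m = total m'.
Proof. by move=> E; apply: eq_bigr. Qed.

Lemma subKm m m' : (forall p, m' p <= m p)%N ->
  m =1 (fun p => m' p + (m p - m' p))%N.
Proof. by move=> H p; rewrite subnKC. Qed.

Lemma divisible_sub e m m' : (forall p, m' p <= m p)%N ->
  divisible e m -> divisible e m' -> divisible e (fun p => m p - m' p)%N.
Proof.
move=> H dm dm' x; rewrite -(dvdn_addr _ (dm' x)).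
by rewrite /wtm -big_split (eq_bigr _ (fun p _ => esym (subKm H p))) dm.
Qed.

Lemma total_sub m m' : (forall p, m' p <= m p)%N ->
  total (fun p => m p - m' p)%N = (total m - total m')%N.
Proof.
by move=> H; rewrite [in RHS](eq_total (subKm H)) total_add addKn.
Qed.

Lemma divisible_point e p : divisible e (fun q => e * ind [set p] q)%N.
Proof. by move=> x; rewrite /wtm -big_distrr dvdn_mulr. Qed.

Lemma total_point e p : total (fun q => e * ind [set p] q)%N = e.
Proof. by rewrite /total -big_distrr /= [X in (_ * X)%N]total_ind cards1 muln1. Qed.

(** Twice the number of columns where two words [x], [y] are both [1] is
    [wt x + wt y - wt (x + y)], a multiple of [8]. *)
Lemma divisible_section m x (b : bool) :
  divisible 8 m -> divisible 4 (fun p => ((dot x p == 1%R) == b) * m p)%N.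
Proof.
move=> dm y.
pose a := (\sum_(p | (dot x p == 1%R) && (dot y p == 1%R)) m p)%N.
have E z (P : pred (word d)) : (\sum_(p | P p) m p = 
  \sum_(p | (dot z p == 1%R) && P p) m p + \sum_(p | (dot z p != 1%R) && P p) m p)%N.
  by rewrite (bigID (fun p => dot z p == 1%R)) /=; congr (_ + _)%N;
     apply: eq_bigl => p; rewrite andbC.
have H : (wtm m x + wtm m y = wtm m (x + y)%R + 2 * a)%N.
  rewrite /wtm (E y (fun p => dot x p == 1%R)) (E x (fun p => dot y p == 1%R)).
  rewrite (E x (fun p => dot (x + y)%R p == 1%R)) -/a.
  have eqs (P Q : pred (word d)) : P =1 Q ->
    (\sum_(p | P p) m p = \sum_(p | Q p) m p)%N by exact: eq_bigl.
  rewrite (eqs (fun p => (dot y p == 1%R) && (dot x p == 1%R))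
    (fun p => (dot x p == 1%R) && (dot y p == 1%R))) -/a; last first.
    by move=> p; rewrite andbC.
  rewrite (eqs (fun p => (dot x p == 1%R) && (dot (x + y)%R p == 1%R))
    (fun p => (dot y p != 1%R) && (dot x p == 1%R))); last first.
    by move=> p; rewrite dotDl; case: (F2P (dot x p)) (F2P (dot y p)) => -> [] ->.
  rewrite (eqs (fun p => (dot x p != 1%R) && (dot (x + y)%R p == 1%R))
    (fun p => (dot x p != 1%R) && (dot y p == 1%R))); last first.
    by move=> p; rewrite dotDl; case: (F2P (dot x p)) (F2P (dot y p)) => -> [] ->.
  by lia.
have a4 : (4 %| a)%N by have := dm x; have := dm y; have := dm (x + y); lia.
rewrite /wtm; case: b.
  suff -> : (\sum_(p | dot y p == 1%R) ((dot x p == 1%R) == true) * m p = a)%N by [].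
  rewrite /a big_mkcondl; apply: eq_bigr => p _.
  by case: (dot x p == 1); rewrite //= mul1n.
have := dm y; rewrite /wtm (E x (fun p => dot y p == 1%R)) -/a => H8.
suff -> : (\sum_(p | dot y p == 1%R) ((dot x p == 1%R) == false) * m p =
  \sum_(p | (dot x p != 1%R) && (dot y p == 1%R)) m p)%N by lia.
rewrite [RHS]big_mkcondl; apply: eq_bigr => p _.
by case: (dot x p == 1); rewrite //= mul1n.
Qed.

Lemma oddset_section m x b :
  oddset (fun p => ((dot x p == 1%R) == b) * m p)%N =
  [set p in oddset m | (dot x p == 1) == b].
Proof. by apply/setP=> p; rewrite !inE; case: (_ == b); rewrite ?andbT ?andbF ?mul1n. Qed.

Lemma size4_section m x b : divisible 8 m -> (8 %| total m)%N ->
  size4 #|[set p in oddset m | (dot x p == 1) == b]|.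
Proof.
move=> dm tm; rewrite -oddset_section; apply: oddset_div4.
  exact: divisible_section.
have E : (\sum_(p | (dot x p == 1%R) == b) m p = total (fun p => ((dot x p == 1%R) == b) * m p))%N.
  by rewrite /total big_mkcond; apply: eq_bigr => p _; case: (_ == b); rewrite ?mul1n.
rewrite -E; suff : (8 %| \sum_(p | (dot x p == 1%R) == b) m p)%N by lia.
have d1 : (8 %| \sum_(p | dot x p == 1%R) m p)%N := dm x.
move: tm; rewrite /total (bigID (fun p => dot x p == 1%R))  /= (dvdn_addr _ d1) => d2.
by case: b {E}; [under eq_bigl do rewrite eqb_id | under eq_bigl do rewrite eqbF_neg].
Qed.

Lemma card_section A x :
  (#|[set p in A | (dot x p == 1%R) == true]| +
   #|[set p in A | (dot x p == 1%R) == false]| = #|A|)%N.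
Proof.
rewrite -(cardsID [set p | dot x p == 1%R] A); congr (_ + _)%N; apply: eq_card => p.
  by rewrite !inE eqb_id.
by rewrite !inE eqbF_neg andbC.
Qed.

Lemma selfdiff_div8 m v : divisible 8 m -> ~~ odd (total m) -> v != 0 ->
  exists2 s, size8 s & (s + selfdiff (oddset m) v = #|oddset m|)%N.
Proof.
move=> dm em v0; apply: (@oddset_step _ 8) v0 => // d' _ m'; exact: oddset_div8.
Qed.

(** Each difference count is [16] or [0], so every difference of two elements is
    a translation that preserves the odd part. *)
Lemma oddset16_flat m : divisible 8 m -> ~~ odd (total m) ->
  #|oddset m| = 16%N -> flat (oddset m).
Proof.
move=> dm em s16 p q r pS qS rS; rewrite addrAC addrC.
have [->|v0] := eqVneq (p + r) 0; first by rewrite addr0.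
apply: selfdiff_full qS.
have [s] := selfdiff_div8 dm em v0; rewrite s16.
have : (0 < selfdiff (oddset m) (p + r))%N.
  by apply/card_gt0P; exists p; rewrite inE pS addKw.
by move: (selfdiff _ _) => N N0 [] *; lia.
Qed.

Lemma flat_half A x p q : flat A -> p \in A -> q \in A -> dot x (p + q) = 1 ->
  (2 * #|[set r in A | dot x r == 1%R]| = #|A|)%N.
Proof.
move=> fA pA qA xpq; rewrite -(card_section A x) mul2n -addnn; congr (_ + _)%N.
  by apply: eq_card => r; rewrite !inE; case: (dot x r == 1).
rewrite -(card_imset _ (@addw_inj _ (p + q))); apply: eq_card => r.
have fpq t : t \in A -> t + (p + q) \in A.
  by move=> tA; rewrite addrA; apply: fA.
rewrite !inE; apply/imsetP/andP => [[r' + ->]|[rA xr]].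
  by rewrite !inE dotDr xpq => /andP[/fpq-> /eqP->].
exists (r + (p + q)); last by rewrite addwK.
rewrite !inE fpq //= dotDr xpq.
by case: (F2P (dot x r)) xr => ->.
Qed.

Lemma flat_divisible A : flat A -> #|A| = 16%N -> divisible 8 (ind A).
Proof.
move=> fA A16 x; rewrite wtm_ind.
have [/existsP[p /existsP[q /and3P[pA qA]]]|] :=
  boolP [exists p, exists q, [&& p \in A, q \in A & dot x (p + q) == 1]].
  by move/eqP/(flat_half fA pA qA); rewrite A16; lia.
move=> H; have [->|[p]] := set_0Vmem [set p in A | dot x p == 1]; first by rewrite cards0.
rewrite inE => /andP[pA /eqP xp].
suff -> : [set p in A | dot x p == 1] = A by rewrite A16.
apply/setP=> q; rewrite inE; case qA : (q \in A) => //=.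
apply: contraNT H => xq; apply/existsP; exists p; apply/existsP; exists q.
by rewrite pA qA dotDr xp; case: (F2P (dot x q)) xq => ->.
Qed.

(** If the length is [8] modulo [16] every coefficient of the transform is at
    least [8] in absolute value, so that the autocorrelation of [m] takes small
    values outside [0]. *)
Lemma conv_bound m v : divisible 8 m -> (total m %% 16 = 8)%N -> v != 0 ->
  conv (fun p => (m p)%:Z) (fun p => (m p)%:Z) v <= (\sum_p m p * m p)%N%:Z - 64.
Proof.
move=> dm tm v0; set f := fun p => (m p)%:Z.
have F64 x : 64 <= ft f x * ft f x.
  have -> : ft f x = ftm m x by [].
  rewrite ftmE; have /dvdnP[w ->] := dm x.
  have [k ->] : exists k, total m = (16 * k + 8)%N by exists (total m %/ 16)%N; lia.
  have [] : (k%:Z - w%:Z >= 0) \/ (k%:Z - w%:Z <= -1) by lia.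
    by nia.
  by nia.
have : 0 <= \sum_x (ft f x * ft f x - 64) * (1 - chi x v).
  apply: sumr_ge0 => x _; have := F64 x.
  by case: (chiP x v) => ->; lia.
have -> : \sum_x (ft f x * ft f x - 64) * (1 - chi x v) =
  \sum_x ft f x * ft f x * chi x 0 - \sum_x ft f x * ft f x * chi x v
  - 64 * (\sum_(x : word d) chi x 0 - \sum_x chi x v).
  rewrite -!sumrB mulr_sumr -sumrB; apply: eq_bigr => x _; rewrite chi0; lia.
rewrite !parseval conv0 !sum_chi eqxx (negPf v0).
have -> : (\sum_p m p * m p)%N%:Z = \sum_p f p * f p by rewrite PoszE.
by have := ordV_gt0 d; nia.
Qed.

Lemma conv_ge m p1 p2 : p1 != p2 ->
  2 * (m p1)%:Z * (m p2)%:Z <=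
    conv (fun p => (m p)%:Z) (fun p => (m p)%:Z) (p1 + p2).
Proof.
move=> p12; rewrite /conv (bigD1 p1) //= (bigD1 p2) 1?eq_sym //=.
rewrite addKw (addrC p1) addKw.
set r := \sum_(i | _) _; have : 0 <= r by apply: sumr_ge0.
by lia.
Qed.

Lemma repetition_bound m p1 p2 : divisible 8 m -> (total m %% 16 = 8)%N -> p1 != p2 ->
  (64 + 2 * (m p1 * m p2) <= \sum_p m p * (m p).-1 + total m)%N.
Proof.
move=> dm tm p12; have v0 : p1 + p2 != 0 by rewrite addw_eq0.
have := le_trans (conv_ge m p12) (conv_bound dm tm v0).
have -> : (\sum_p m p * m p = \sum_p m p * (m p).-1 + total m)%N.
  by rewrite /total -big_split; apply: eq_bigr => p _ /=; case: (m p) => //= k; lia.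
by lia.
Qed.

(** With few repeated columns, none of them often, [repetition_bound] is violated
    by the two most frequent ones, up to one extremal configuration. *)
Lemma light_bound m : (forall p, m p <= 7)%N -> (\sum_p (m p)./2 <= 6)%N ->
  (7 < total m)%N -> exists p1 p2, [/\ p1 != p2,
    forall p, p != p1 -> (m p <= m p2)%N &
    (m p1 = 7 /\ m p2 = 1)%N \/ (\sum_p m p * (m p).-1 < 24 + 2 * (m p1 * m p2))%N].
Proof.
move=> m7 half tm.
have [p1 _ max1] := @arg_maxnP _ 0 xpredT m isT.
have [p0 p01] : exists p0, (p0 != p1) && (0 < m p0)%N.
  apply/existsP; apply: contraTT tm; rewrite negb_exists -leqNgt => /forallP H.
  rewrite /total (bigD1 p1) //= big1 ?addn0 // => p pp1.
  by have := H p; rewrite pp1 /=; lia.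
have [p2 /= p21 max2] := @arg_maxnP _ p0 (fun p => p != p1) m (proj1 (andP p01)).
have m20 : (0 < m p2)%N.
  by case/andP: p01 => n01 m0; have := max2 _ n01; lia.
exists p1, p2; split; first by rewrite eq_sym.
  by move=> p /max2.
have D2 (f : word d -> nat) :
    (\sum_p f p = f p1 + (f p2 + \sum_(p | (p != p1) && (p != p2)) f p))%N.
  by rewrite (bigD1 p1) //= (bigD1 p2).
move: half; rewrite !D2.
set H := (\sum_(i | _) _)%N; set R := (\sum_(i | _) _)%N => half.
(* k bounds a (a - 1) / floor (a / 2) for 2 <= a <= m p2. *)
pose k := nth 0%N [:: 0; 0; 2; 6; 6; 10; 10; 14]%N (m p2).
have RH : (R <= k * H)%N.
  rewrite /R /H big_distrr /=; apply: leq_sum => p /andP[/max2 pp _].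
  move: pp (m7 p2) m20; rewrite /k.
  by move: (m p) (m p2) => [|[|[|[|[|[|[|[|a]]]]]]]] [|[|[|[|[|[|[|[|b]]]]]]]] //=; lia.
have := max1 p2 isT; move: half RH (m7 p1) m20; rewrite /k.
by move: (m p1) (m p2) => [|[|[|[|[|[|[|[|a]]]]]]]] [|[|[|[|[|[|[|[|b]]]]]]]] //= *; lia.
Qed.

Lemma total_half m : total m = (2 * (\sum_p (m p)./2) + #|oddset m|)%N.
Proof.
rewrite /total card_oddset big_distrr -big_split; apply: eq_bigr => p _ /=.
by rewrite mul2n addnC odd_double_half.
Qed.

(** A nonempty odd part has at least [16] points, which leaves room for at most
    [4] repetitions: too few for [repetition_bound] if no column is frequent. *)
Lemma heavy24 m : divisible 8 m -> total m = 24%N -> oddset m != set0 ->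
  exists p, (8 <= m p)%N.
Proof.
move=> dm tm S0; apply/existsP; apply: contraNT S0; rewrite negb_exists => /forallP H.
have m7 p : (m p <= 7)%N by have := H p; lia.
rewrite -cards_eq0; have := oddset_div8 dm; rewrite tm => /(_ isT).
have := total_half m; rewrite tm => tE s8.
have [//|s0] := eqVneq #|oddset m| 0%N.
have half : (\sum_p (m p)./2 <= 4)%N by case: s8 => ?; lia.
have [|p1 [p2 [p12 max2 alt]]] := light_bound m7 (leq_trans half (isT : 4 <= 6)%N).
  by rewrite tm.
have := repetition_bound dm _ p12; rewrite tm => /(_ erefl).
case: alt => [[e1 e2]|]; last by lia.
rewrite (bigD1 p1) //= big1 ?e1 ?e2 // => p /max2; rewrite e2.
by case: (m p) => [|[]].
Qed.
End Basics.

(** * Length 40 *)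

Section Forty.
Variable d : nat.
Implicit Types (m : word d -> nat) (A : {set word d}) (x p q v : word d).

(** The configuration left over by [light_bound].  The columns off [z] are [33]
    distinct ones.  For each [x] those separated from [z] by [x] form a codeword
    or the complement of one, so their number is divisible by [8]; it is at most
    [16], as [24] and [32] would leave sections of sizes [10] and [2].  Then all
    Fourier coefficients of the odd part, normalized at [z], are at least [2],
    whereas their mean is [1]. *)
Lemma single_heavy40 m z : divisible 8 m -> total m = 40%N ->
  m z = 7%N -> (forall p, p != z -> (m p <= 1)%N) -> False.
Proof.
move=> dm tm mz m1; set S := oddset m.
have zS : z \in S by rewrite inE mz.
have mS p : p != z -> m p = (p \in S).
  by move=> /m1; rewrite inE; case: (m p) => [|[]].
have s34 : #|S| = 34%N.
  have := total_half m; rewrite tm (bigD1 z) //= big1 ?mz -/S; first by lia.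
  by move=> p /m1; case: (m p) => [|[]].
pose far x := #|[set p in S | (dot x p == 1) == ~~ (dot x z == 1)]|.
have far_le x : (far x <= 16)%N.
  have far8 : (8 %| far x)%N.
    have E : (far x = \sum_(p | (dot x p == 1%R) == ~~ (dot x z == 1%R)) m p)%N.
      rewrite /far -sum1dep_card big_mkcondl big_mkcond [RHS]big_mkcond.
      apply: eq_bigr => p _; have [->|/mS ->] := eqVneq p z.
        by case: (dot x z == 1).
      by case: (p \in S); case: ifP.
    have := dm x; have : (8 %| total m)%N by rewrite tm.
    rewrite E /total /wtm (bigID (fun p => dot x p == 1%R)) /= => d1 d2.
    case: (dot x z == 1) => /=; last by under eq_bigl do rewrite eqb_id.
    by under eq_bigl do rewrite eqbF_neg; rewrite (dvdn_addr _ d2) in d1.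
  have tm8 : (8 %| total m)%N by rewrite tm.
  have := size4_section x (~~ (dot x z == 1)) dm tm8.
  have := size4_section x (dot x z == 1) dm tm8.
  have := card_section S x; rewrite s34 -/S.
  move: far8; rewrite /far.
  case: (dot x z == 1) => /=; move: #|_| #|_| => a b h1 h2 [] h3 [] h4; lia.
have E x : ft (fun p => (p \in S)%:Z) x * chi x z = 34 - 2 * (far x)%:Z.
  have -> : (34 : int) = #|S|%:Z by rewrite s34.
  rewrite /far -sum1_card -sum1dep_card !PoszE big_mkcond [X in 2 * X]big_mkcond.
  rewrite /ft mulr_suml [X in _ - X]mulr_sumr -sumrB; apply: eq_bigr => p _.
  rewrite !dot_eq1; case: (p \in S) => /=; last by lia.
  by case: (chiP x p) (chiP x z) => -> [] ->.
have := ft_inv (fun p => (p \in S)%:Z) z; rewrite zS mulr1.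
have : \sum_(x : word d) (2 : int) <= \sum_x ft (fun p => (p \in S)%:Z) x * chi x z.
  by apply: ler_sum => x _; rewrite E; have := far_le x; lia.
rewrite sumr_const -/(ordV d) => H1 H2; rewrite H2 in H1.
have := ordV_gt0 d; move: H1; rewrite /ordV pmulrn mulrzz.
by rewrite (_ : #|xpredT| = #|{: word d}|) ?(eq_card (fun _ => erefl)) //; lia.
Qed.

(** The triples with sum [p] of the form [(p, q, q)], up to order. *)
Lemma third_moment_ge m p (f := fun q => (m q)%:Z) :
  3 * f p * (\sum_q f q * f q) - 2 * f p * f p * f p <= conv (conv f f) f p.
Proof.
have -> : conv (conv f f) f p = \sum_q conv f f (q + p) * f q.
  by rewrite -[RHS](sum_shift _ p); apply: eq_bigr => q _; rewrite addwK.
rewrite [X in _ <= X](bigD1 p) //= addww conv0.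
have H : \sum_(q | q != p) 2 * f p * (f q * f q) <=
    \sum_(q | q != p) conv f f (q + p) * f q.
  apply: ler_sum => q qp; have -> : 2 * f p * (f q * f q) = 2 * f q * f p * f q by lia.
  by apply: ler_wpM2r; last exact: conv_ge.
rewrite -mulr_sumr in H; move: H.
have -> : \sum_q f q * f q = f p * f p + \sum_(q | q != p) f q * f q.
  by rewrite (bigD1 p).
move: (f p) (\sum_(q | q != p) f q * f q) => u a.
by move: (\sum_(q | _) _) => c; lia.
Qed.

(** Let [X] and [Y] be the transforms of the odd part [S] and of the halves [mu]
    of the multiplicities.  By [size4_section] the values of [X] are [0], [+-8]
    and [+-24], and [X + 2 Y = 8] modulo [16] determines [Y] modulo [8].  The
    fourth moment of [X] is bounded below because the difference counts of [S] are
    [0] or at least [8]: many characters are constant on [S].  If all [mu p <= 3]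
    then the third moment of [Y], whose only large values are taken at characters
    constant on the support of [mu], is too small for a point with [mu p >= 2]; and
    if all [mu p <= 1] the second moment is. *)
Lemma light40 m : divisible 8 m -> total m = 40%N -> #|oddset m| = 24%N ->
  exists p, (8 <= m p)%N.
Proof.
move=> dm tm s24; apply/existsP; apply: contraT; rewrite negb_exists => /forallP H.
set S := oddset m; pose mu p := ((m p)./2)%N.
have mu3 p : (mu p <= 3)%N by rewrite /mu; have := H p; lia.
have mu8 : total mu = 8%N by have := total_half m; rewrite tm s24 /total /mu; lia.
pose f p : int := (p \in S)%:R; pose X := ft f; pose Y := ftm mu.
pose D := ordV d.
have D0 : 0 < D := ordV_gt0 d.
have FE x : exists k : int, X x + 2 * Y x = 16 * k + 8.
  have -> : X x + 2 * Y x = ftm m x.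
    rewrite /X /Y /ftm /ft mulr_sumr -big_split; apply: eq_bigr => p _ /=.
    by rewrite /f /mu inE -[in RHS](odd_double_half (m p)); case: (odd _) => /=; lia.
  by rewrite ftmE tm; have /dvdnP[w ->] := dm x; exists (2 - w%:Z); lia.
have XE x : [\/ X x = 0, X x = 8 \/ X x = -8 | X x = 24 \/ X x = -24].
  have E : X x = 24 - 2 * #|[set p in S | (dot x p == 1) == true]|%:Z.
    have -> : (24 : int) = #|S|%:Z by rewrite s24.
    rewrite -sum1_card -sum1dep_card !PoszE big_mkcond [X in 2 * X]big_mkcond.
    rewrite /X /ft mulr_sumr -sumrB; apply: eq_bigr => p _.
    rewrite /f !dot_eq1 -/S; case: (p \in S) => /=; last by lia.
    by case: (chiP x p) => ->.
  have tm8 : (8 %| total m)%N by rewrite tm.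
  have := size4_section x true dm tm8; have := size4_section x false dm tm8.
  have := card_section S x; rewrite s24; rewrite -/S in E *.
  move: E; rewrite -/S; move: #|_| #|_| => a b -> ab B A.
  have [e|[e|[e|[e|e]]]] : (b = 0 \/ b = 8 \/ b = 12 \/ b = 16 \/ b = 24)%N.
  - by case: A => ?; case: B => ?; lia.
  - by constructor 3; left; rewrite e.
  - by constructor 2; left; rewrite e.
  - by constructor 1; rewrite e.
  - by constructor 2; right; rewrite e.
  - by constructor 3; right; rewrite e.
have Y8 x : `|Y x| <= 8 by have := ftm_le mu x; rewrite mu8.
have YE x : (X x != 0 -> [\/ Y x = 0, Y x = 8 | Y x = -8]) /\
            (X x = 0 -> Y x = 4 \/ Y x = -4).
  have [k FEx] := FE x; have {}Y8 := Y8 x; move: FEx Y8 (XE x).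
  move: (X x) (Y x) => a b E b8 A; split=> [/eqP a0|a0]; last by lia.
  have [|[|]] : b = 0 \/ b = 8 \/ b = -8 by case: A => [|[]|[]] ?; lia.
  - by constructor 1.
  - by constructor 2.
  - by constructor 3.
pose L := \sum_x (X x != 0)%:R : int.
pose G := \sum_x (`|X x| == 24)%:R : int.
pose A := \sum_x (`|Y x| == 8)%:R : int.
have sum1 : \sum_(x : word d) (1 : int) = D.
  by rewrite sumr_const pmulrn mulrzz mul1r /D /ordV; congr _%:Z; apply: eq_card.
have NE v : conv f f v = (selfdiff S v)%:Z by rewrite selfdiffE.
have X2 : 64 * L + 512 * G = D * 24.
  have := parseval f f 0; rewrite NE selfdiff0 s24 => <-.
  rewrite /L /G !mulr_sumr -big_split; apply: eq_bigr => x _ /=.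
  by rewrite chi0 mulr1 -/(X x); case: (XE x) => [->|[] ->|[] ->].
have X4 : D * 78 <= 64 * (L + 80 * G).
  have : 64 * (64 * (L + 80 * G)) = D * \sum_v conv f f v * conv f f v.
    rewrite -conv0 -parseval /L /G [80 * _]mulr_sumr -big_split !mulr_sumr.
    apply: eq_bigr => x _ /=.
    rewrite ft_conv chi0 mulr1 -/(X x).
    pose c : int := (X x != 0)%:R + 8 * (`|X x| == 24)%:R.
    have -> : X x * X x = 64 * c by rewrite /c; case: (XE x) => [->|[] ->|[] ->].
    have -> : (X x != 0)%:R + 80 * (`|X x| == 24)%:R = c * c.
      by rewrite /c; case: (XE x) => [->|[] ->|[] ->].
    by move: c => c; lia.
  rewrite (bigD1 0) //= NE selfdiff0 s24.
  have : \sum_(v | v != 0) 8 * (selfdiff S v)%:Z <= \sum_(v | v != 0) conv f f v * conv f f v.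
    apply: ler_sum => v v0; rewrite NE.
    have [|s' s8] := selfdiff_div8 dm _ v0; first by rewrite tm.
    by rewrite -/S s24; move: (selfdiff S v) => N; case: s8 => ?; nia.
  rewrite -mulr_sumr -PoszE sum_selfdiff s24.
  by set r := \sum_(v | _) _; move: (L + _) => t r0 E; nia.
pose g q := (mu q)%:Z; pose Q := \sum_q g q * g q.
have Y2 : D * Q = 16 * (D - L) + 64 * A.
  rewrite /Q -conv0 -parseval -sum1 /L /A -sumrB !mulr_sumr -big_split.
  apply: eq_bigr => x _ /=; rewrite chi0 mulr1 -/(ftm mu x) -/(Y x).
  have [X0|X0] := eqVneq (X x) 0.
    by have [_ /(_ X0)[]->] := YE x.
  by have [/(_ X0)[]-> _] := YE x.
have Y3 p : (0 < mu p)%N -> D * (16 * g p) + 384 * A = D * conv (conv g g) g p.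
  move=> mup; rewrite -parseval -mulrCA -(ft_inv g) /A !mulr_sumr -big_split.
  apply: eq_bigr => x _ /=; rewrite ft_conv -/(ftm mu x) -/(Y x).
  have : 2 * g p <= (total mu)%:Z + Y x * chi x p.
    rewrite /total PoszE /Y /ftm /ft mulr_suml -big_split (bigD1 p) //= -mulrA chi_sq.
    set r := \sum_(i | _) _; suff : 0 <= r by rewrite /g; lia.
    apply: sumr_ge0 => q _; rewrite -mulrA.
    by case: (chiP x p) (chiP x q) => -> [] ->; lia.
  rewrite mu8 /g; have := chi_sq x p; case: (chiP x p) => -> _.
    have [X0|X0] := eqVneq (X x) 0; first by have [_ /(_ X0)[]->] := YE x.
    by have [/(_ X0)[]-> _] := YE x => //; lia.
  have [X0|X0] := eqVneq (X x) 0; first by have [_ /(_ X0)[]->] := YE x.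
  by have [/(_ X0)[]-> _] := YE x => //; lia.
have G0 : 0 <= G by apply: sumr_ge0.
have A0 : 0 <= A by apply: sumr_ge0.
have mu1 p : (mu p <= 1)%N.
  rewrite leqNgt; apply/negP => mup.
  have T := third_moment_ge mu p; rewrite -/g -/Q in T.
  have := Y3 p (ltnW mup); have : D * (3 * g p * Q - 2 * g p * g p * g p) <= D * conv (conv g g) g p.
    by rewrite ler_pM2l.
  have [e|e] : g p = 2 \/ g p = 3 by have := mu3 p; rewrite /g; lia.
    by rewrite e; lia.
  by rewrite e; lia.
have Q8 : Q = 8.
  have -> : (8 : int) = (total mu)%:Z by rewrite mu8.
  by rewrite /Q /total PoszE; apply: eq_bigr => q _; have := mu1 q; rewrite /g; case: (mu q) => [|[]].
by rewrite Q8 in Y2; lia.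
Qed.

(** An odd part of at least [28] points leaves room for at most [6] repetitions. *)
Lemma heavy40 m : divisible 8 m -> total m = 40%N ->
  [\/ #|oddset m| = 0%N, #|oddset m| = 16%N | exists p, (8 <= m p)%N].
Proof.
move=> dm tm; have := oddset_div8 dm; rewrite tm => /(_ isT) [e|e|e|s28].
- by constructor 1.
- by constructor 2.
- by constructor 3; apply: light40.
constructor 3; apply/existsP; apply: contraT; rewrite negb_exists => /forallP H.
have m7 p : (m p <= 7)%N by have := H p; lia.
have half : (\sum_p (m p)./2 <= 6)%N by have := total_half m; rewrite tm; lia.
have [|p1 [p2 [p12 max2 alt]]] := light_bound m7 half; first by rewrite tm.
have := repetition_bound dm _ p12; rewrite tm => /(_ erefl).
case: alt => [[e1 e2] _|]; last by lia.
by case: (single_heavy40 dm tm e1); move=> p /max2; rewrite e2.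
Qed.


End Forty.

(** * Length 32 *)

Section ThirtyTwo.
Variable d : nat.
Implicit Types (m : word d -> nat) (A : {set word d}) (x p q v : word d).

(** The equality case of the triangle inequality. *)
Lemma ftm_extremal m x q : (0 < m q)%N -> `|ftm m x| = (total m)%:Z ->
  ftm m x = (total m)%:Z * chi x q.
Proof.
move=> mq Fx; have : 2 * (m q)%:Z <= (total m)%:Z + ftm m x * chi x q.
  rewrite /total PoszE /ftm /ft mulr_suml -big_split (bigD1 q) //= -mulrA chi_sq.
  set r := \sum_(i | _) _; suff : 0 <= r by lia.
  apply: sumr_ge0 => q' _; rewrite -mulrA.
  by case: (chiP x q) (chiP x q') => -> [] ->; lia.
by case: (chiP x q) => ->; lia.
Qed.

(** The characters with nonzero coefficient are constant on the support, so by
    inversion [m] is uniform on the flat where they take these values.  The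
    common multiplicity is odd and divides [8]. *)
Lemma eight_flat m p : total m = 8%N ->
  (forall x, [\/ ftm m x = 0, ftm m x = 8 | ftm m x = -8]) -> odd (m p) ->
  [/\ m =1 ind (oddset m), flat (oddset m) & #|oddset m| = 8%N].
Proof.
move=> t8 F8 op.
have sgn x q : (0 < m q)%N -> ftm m x != 0 -> ftm m x = 8 * chi x q.
  move=> mq F0; rewrite (ftm_extremal mq) t8 //.
  by case: (F8 x) F0 => ->; rewrite ?eqxx.
pose K := \sum_x (ftm m x != 0)%:R : int.
have mK q : (0 < m q)%N -> ordV d * (m q)%:Z = 8 * K.
  move=> mq; rewrite -(ft_inv (fun p => (m p)%:Z)) /K mulr_sumr.
  apply: eq_bigr => x _; rewrite -/(ftm m x).
  have [->|F0] := eqVneq (ftm m x) 0; first by rewrite mul0r mulr0.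
  by rewrite (sgn _ _ mq F0) -mulrA chi_sq.
have mp : (0 < m p)%N by case: (m p) op.
have same q : (0 < m q)%N -> m q = m p.
  by move=> mq; have := mK p mp; rewrite -(mK q mq); have := ordV_gt0 d; nia.
have odd8 : (8 = m p * #|oddset m|)%N.
  rewrite -t8 /total card_oddset big_distrr; apply: eq_bigr => q _ /=.
  by case: (posnP (m q)) => [->|/same->]; rewrite ?muln0 // op muln1.
have mp1 : m p = 1%N.
  have : (m p %| 8)%N by rewrite odd8 dvdn_mulr.
  by move: op; case: (m p) => [|[|[|[|[|[|[|[|[|k]]]]]]]]] // _ /dvdn_leq -/(_ isT).
have S0 q : (q \in oddset m) = (0 < m q)%N.
  by rewrite inE; case: (posnP (m q)) => [->|/same->].
split; last by rewrite mp1 mul1n in odd8.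
  move=> q; rewrite /ind S0; case: (posnP (m q)) => [->|mq] //.
  by rewrite same // mp1.
move=> a b c; rewrite !S0 => ma mb mc.
have E : ordV d * (m (a + b + c))%:Z = 8 * K.
  rewrite -(ft_inv (fun p => (m p)%:Z)) /K mulr_sumr.
  apply: eq_bigr => x _; rewrite -/(ftm m x) !chiD.
  have [->|Fx] := eqVneq (ftm m x) 0; first by rewrite mul0r mulr0.
  have e1 := sgn _ _ ma Fx; rewrite (sgn _ _ mb Fx) in e1.
  rewrite (sgn _ _ mc Fx); have -> : chi x a = chi x b by lia.
  by rewrite chi_sq mul1r -mulrA chi_sq.
by have := mK _ ma; rewrite -E same //; have := ordV_gt0 d; nia.
Qed.
Lemma flat_halving A x p : flat A -> p \in A ->
  let A' := [set r in A | chi x r == chi x p] in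
  [/\ flat A', p \in A', (#|A| <= 2 * #|A'|)%N &
    forall q, q \in A -> chi x q != chi x p -> (2 * #|A'| = #|A|)%N].
Proof.
move=> fA pA /=; set A' := [set r in A | _].
have half q : q \in A -> chi x q != chi x p -> (2 * #|A'| = #|A|)%N.
  move=> qA xq; have xpq : dot x (p + q) = 1.
    apply/eqP; rewrite dot_eq1 chiD; move: xq.
    by case: (chiP x p) (chiP x q) => -> [] ->.
  have h1 := flat_half fA pA qA xpq; have h2 := card_section A x.
  case xp : (dot x p == 1).
    rewrite -h1; congr (2 * _)%N; apply: eq_card => r; rewrite !inE dot_eq1.
    by move: xp; rewrite dot_eq1 => /eqP ->.
  have -> : A' = [set r in A | (dot x r == 1) == false].
    apply/setP=> r; rewrite !inE dot_eq1; congr (_ && _).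
    by move: xp; rewrite dot_eq1; case: (chiP x p) (chiP x r) => -> [] ->.
  have e : #|[set r in A | dot x r == 1]| = #|[set r in A | (dot x r == 1) == true]|.
    by apply: eq_card => r; rewrite !inE eqb_id.
  by rewrite e in h1; lia.
split=> //.
- move=> a b c; rewrite !inE => /andP[aA /eqP ea] /andP[bA /eqP eb] /andP[cA /eqP ec].
  by rewrite fA // !chiD ea eb ec chi_sq mul1r eqxx.
- by rewrite inE pA eqxx.
have [/existsP[q /andP[qA xq]]|H] := boolP [exists q, (q \in A) && (chi x q != chi x p)].
  by rewrite (half q).
suff -> : A' = A by lia.
apply/setP=> r; rewrite inE; case rA : (r \in A) => //=.
by apply: contraNT H => xr; apply/existsP; exists r; rewrite rA.
Qed.

Lemma flat_double A u p : flat A -> p \in A -> p + u \notin A ->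
  let G := A :|: [set q + u | q in A] in flat G /\ #|G| = (2 * #|A|)%N.
Proof.
move=> fA pA puA G; split.
  have key (a b c : word d) (i j k : 'F_2) : a \in A -> b \in A -> c \in A ->
      (a + i *: u) + (b + j *: u) + (c + k *: u) \in G.
    move=> aA bA cA.
    have -> : (a + i *: u) + (b + j *: u) + (c + k *: u) = (a + b + c) + (i + j + k) *: u.
      by rewrite !scalerDl (addrACA a) (addrACA (a + b)).
    rewrite inE; apply/orP; case: (F2P (i + j + k)) => ->.
      by left; rewrite scale0r addr0 fA.
    by right; apply/imsetP; exists (a + b + c); rewrite ?fA // scale1r.
  have GP r : r \in G -> exists2 a, a \in A & exists i : 'F_2, r = a + i *: u.
    rewrite inE => /orP[rA|/imsetP[a aA ->]].
      by exists r => //; exists 0; rewrite scale0r addr0.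
    by exists a => //; exists 1; rewrite scale1r.
  by move=> p1 p2 p3 /GP[a aA [i ->]] /GP[b bA [j ->]] /GP[c cA [k ->]]; apply: key.
rewrite cardsU (card_imset _ (@addw_inj _ u)) mul2n -addnn.
suff -> : A :&: [set q + u | q in A] = set0 by rewrite cards0 subn0.
apply/setP=> r; rewrite !inE; apply/andP=> -[rA /imsetP[q qA rE]].
case/negP: puA; have := fA _ _ _ pA qA rA.
by rewrite rE -addrA addKw.
Qed.

(** Otherwise replacing the flat by [8] copies of the missing point [r0] leads to
    [24] columns with a column of multiplicity [7].  This contradicts [heavy24]:
    off a column of multiplicity [8] there are [16] columns, which would have to
    be distinct. *)
Lemma almost_flat m G r0 : divisible 8 m -> total m = 32%N ->
  flat G -> #|G| = 16%N -> (forall r, r \in G -> r != r0 -> (0 < m r)%N) ->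
  forall r, (ind G r <= m r)%N.
Proof.
move=> dm tm fG cG Gm r; have [r0G|r0G] := boolP ((r0 \in G) && (m r0 == 0)%N); last first.
  rewrite /ind; case rG : (r \in G) => //; have [e|] := eqVneq r r0; last exact: Gm.
  by move: r0G; rewrite -e rG /= lt0n.
exfalso; case/andP: r0G => r0G /eqP mr0 {r}.
pose m8 r := (m r + 8 * ind [set r0] r)%N.
have le8 r : (ind G r <= m8 r)%N.
  rewrite /m8 /ind inE; case: eqP => [_|/eqP rr0]; first by case: (_ \in _); lia.
  by case rG : (r \in G); rewrite // addn_gt0 Gm.
pose m1 r := (m8 r - ind G r)%N.
have d1 : divisible 8 m1.
  apply: divisible_sub le8 _ (flat_divisible fG cG).
  by apply: divisible_add; last exact: divisible_point.
have t1 : total m1 = 24%N.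
  by rewrite total_sub // total_add total_point total_ind tm cG.
have m1r : m1 r0 = 7%N by rewrite /m1 /m8 /ind r0G inE eqxx mr0.
have [|z mz] := heavy24 d1 t1.
  by apply/set0Pn; exists r0; rewrite inE m1r.
have le1 r : (8 * ind [set z] r <= m1 r)%N.
  by rewrite /ind inE; case: eqP => [->|]; rewrite ?muln0 ?muln1.
pose m2 r := (m1 r - 8 * ind [set z] r)%N.
have d2 : divisible 8 m2 by apply: divisible_sub le1 d1 (divisible_point _ _).
have t2 : total m2 = 16%N by rewrite total_sub // total_point t1.
have m2r : m2 r0 = 7%N.
  rewrite /m2 /ind inE; case: eqP => [e|]; last by rewrite muln0 subn0 m1r.
  by rewrite -e m1r in mz.
have := total_half m2; rewrite t2 (bigD1 r0) //= m2r.
have : (0 < #|oddset m2|)%N by apply/card_gt0P; exists r0; rewrite inE m2r.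
have := oddset_div8 d2; rewrite t2 => /(_ isT).
have -> : 7./2 = 3%N by [].
move: #|_| (bigop _ _ _) => s R s8 s0 E; clear - s8 s0 E.
by case: s8 => ?; lia.
Qed.

(** Let [p] be a column of odd multiplicity and [y] a codeword of weight [8] that
    sees [p], or of weight [24] that does not: the columns on the same side of [y]
    as [p] form a flat [W y] of [8] simple columns, by [eight_flat].  When the
    characters with nonzero coefficient span, there are four such words whose
    flats meet in [p] only, and their union is a flat of size [16] without a
    point. *)
Lemma length32 m : divisible 8 m -> total m = 32%N ->
  [\/ oddset m = set0, exists2 v, v != 0 & forall p, m (p + v) = m p |
      exists G, [/\ flat G, #|G| = 16%N & forall p, (ind G p <= m p)%N]].
Proof.
move=> dm tm; pose F := ftm m.
have FE x : [\/ F x = 0, F x = 16 \/ F x = -16 | `|F x| = 32].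
  have := ftm_le m x; rewrite -/F tm; have : exists k : int, F x = 16 * k.
    by rewrite /F ftmE tm; have /dvdnP[w ->] := dm x; exists (2 - w%:Z); lia.
  case=> k Fk; have [k0|[k1|k2]] : k = 0 \/ (`|k| = 1) \/ (`|k| >= 2) by lia.
  - by constructor 1; rewrite Fk k0 mulr0.
  - by constructor 2; lia.
  - by constructor 3; lia.
have F32 x q : (0 < m q)%N -> `|F x| = 32 -> F x = 32 * chi x q.
  by move=> mq Fx; rewrite /F (ftm_extremal mq) tm.
have [/existsP[v /andP[v0 /forallP Hv]]|span] :=
  boolP [exists v, (v != 0) && [forall x, (F x != 0) ==> (chi x v == 1)]].
  constructor 2; exists v => // p; apply/eqP; rewrite -eqz_nat; apply/eqP.
  apply: (mulfI (lt0r_neq0 (ordV_gt0 d))).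
  rewrite -!(ft_inv (fun p => (m p)%:Z)); apply: eq_bigr => x _.
  rewrite -[ft _ x]/(F x); have := Hv x; have [->|_ /eqP e] := eqVneq (F x) 0; first by rewrite !mul0r.
  by rewrite chiD e mulr1.
have {}span v : v != 0 -> exists2 x, F x != 0 & chi x v = -1.
  move=> v0; have /existsP[x] : [exists x, (F x != 0) && (chi x v != 1)].
    apply: contraNT span; rewrite negb_exists => /forallP H.
    apply/existsP; exists v; rewrite v0; apply/forallP=> x.
    by have := H x; case: (F x != 0) => //=; rewrite negbK.
  by case/andP=> Fx xv; exists x => //; case: (chiP x v) xv => ->.
have [S0|Sn0] := eqVneq (oddset m) set0; first by constructor 1.
constructor 3.
have [p pS [y0 Fy0]] : exists2 p, p \in oddset m & exists y, F y * chi y p = -16.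
  have [p pS] := set0Pn _ Sn0.
  have [q qS pq] : exists2 q, q \in oddset m & p != q.
    have : (1 < #|oddset m|)%N.
      have : (0 < #|oddset m|)%N by apply/card_gt0P; exists p.
      by have := odd_total m; rewrite tm; case: #|_| => [|[]].
    case/card_gt1P=> a [b [aS bS ab]]; case: (eqVneq p a) ab => [->|pa _].
      by exists b.
    by exists a.
  have [|x Fx xpq] := span (p + q); first by rewrite addw_eq0.
  have mp : (0 < m p)%N by move: pS; rewrite inE; case: (m p).
  have mq : (0 < m q)%N by move: qS; rewrite inE; case: (m q).
  have xq : chi x q = - chi x p.
    by move: xpq; rewrite chiD; case: (chiP x p) (chiP x q) => -> [] ->.
  case: (FE x) => [F0|F16|F32']; first by rewrite F0 eqxx in Fx.
    have [e|e] : F x * chi x p = -16 \/ F x * chi x q = -16.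
    - by rewrite xq; case: F16 => ->; case: (chiP x p) => ->; [right|left|left|right].
    - by exists p => //; exists x.
    - by exists q => //; exists x.
  by have := F32 x p mp F32'; rewrite (F32 x q mq F32') xq; case: (chiP x p) => ->.
have mp : (0 < m p)%N by move: pS; rewrite inE; case: (m p).
pose w y q := ((chi y q == chi y p) * m q)%N.
have wF y z : 2 * ftm (w y) z = F z + chi y p * F (y + z).
  rewrite /F /ftm /ft !mulr_sumr -big_split; apply: eq_bigr => q _ /=.
  rewrite chiDl /w; case: (chiP y p) (chiP y q) => -> [] ->; lia.
pose W y := oddset (w y).
have WP y : F y * chi y p = -16 -> flat (W y) /\ [/\ #|W y| = 8%N, p \in W y,
    (forall q, (q \in W y) = (0 < m q)%N && (chi y q == chi y p)),
    (forall q, q \in W y -> m q = 1%N) &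
    forall z q, q \in W y -> chi z q != chi z p -> F z + chi y p * F (y + z) = 0].
  move=> Fy.
  have t8 : total (w y) = 8%N.
    have := wF y 0; rewrite /ftm ft0 -PoszE -/(total (w y)) addr0.
    rewrite {1}/F /ftm ft0 -PoszE -/(total m) tm; lia.
  have F8 z : [\/ ftm (w y) z = 0, ftm (w y) z = 8 | ftm (w y) z = -8].
    have := ftm_le (w y) z; have := wF y z; rewrite t8.
    have [k Fk] : exists k : int, F z = 16 * k.
      by rewrite /F ftmE tm; have /dvdnP[u ->] := dm z; exists (2 - u%:Z); lia.
    have [k' Fk'] : exists k : int, F (y + z) = 16 * k.
      by rewrite /F ftmE tm; have /dvdnP[u ->] := dm (y + z); exists (2 - u%:Z); lia.
    rewrite Fk Fk' => e le8; have {}e : ftm (w y) z = 8 * (k + chi y p * k').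
      by case: (chiP y p) e => ->; lia.
    move: (k + _) e => t e.
    have [|[|]] : t = 0 \/ t = 1 \/ t = -1 by lia.
    - by move=> t0; constructor 1; rewrite e t0.
    - by move=> t0; constructor 2; rewrite e t0.
    - by move=> t0; constructor 3; rewrite e t0.
  have op : odd (w y p) by rewrite /w eqxx mul1n; rewrite inE in pS.
  have [wE fW cW] := eight_flat t8 F8 op.
  have mem q : (q \in W y) = (0 < m q)%N && (chi y q == chi y p).
    have := wE q; rewrite /ind -/(W y) /w.
    by case: (chi y q == chi y p); case: (q \in W y); case: (m q) => [|[]].
  have one q : q \in W y -> m q = 1%N.
    move=> qW; have := wE q; rewrite /ind -/(W y) qW /w.
    by move: qW; rewrite mem => /andP[_ ->]; rewrite mul1n.
  split=> //; split=> //; first by rewrite mem mp eqxx.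
  move=> z q qW zq; rewrite -wF; have [-> //|Fz] := eqVneq (ftm (w y) z) 0.
  have ext r : r \in W y -> ftm (w y) z = 8%:Z * chi z r.
    move=> rW; rewrite -t8; apply: ftm_extremal.
      by rewrite wE /ind -/(W y) rW.
    by rewrite t8; case: (F8 z) Fz => ->; rewrite ?eqxx.
  have := ext q qW; rewrite (ext p) ?mem ?mp ?eqxx // => /eqP.
  by move: zq; case: (chiP z p) (chiP z q) => -> [] ->.
move: W WP => W WP {w wF}.
have [fW0 [c0 p0 mem0 one0 orth0]] := WP _ Fy0.
(* The characters in the support separate the points of W y0; changing one by y0
   if necessary, it is of the same kind as y0. *)
have sep q : q \in W y0 -> q != p -> exists2 y, F y * chi y p = -16 & chi y q != chi y p.
  move=> qW qp; have [|x Fx xpq] := span (p + q); first by rewrite addw_eq0 eq_sym.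
  have xq : chi x q = - chi x p.
    by move: xpq; rewrite chiD; case: (chiP x p) (chiP x q) => -> [] ->.
  have xqp : chi x q != chi x p by rewrite xq; case: (chiP x p) => ->.
  case: (FE x) => [F0|F16|F32']; first by rewrite F0 eqxx in Fx.
    have [e|e] : F x * chi x p = -16 \/ F x * chi x p = 16.
      by case: F16 => ->; case: (chiP x p) => ->; [right|left|left|right].
      by exists x.
    exists (y0 + x).
      have := orth0 x q qW xqp; rewrite chiDl; move: e.
      by case: (chiP y0 p) (chiP x p) => -> [] ->; lia.
    rewrite !chiDl xq; move: qW; rewrite mem0 => /andP[_ /eqP->].
    by case: (chiP y0 p) (chiP x p) => -> [] ->.
  have mq : (0 < m q)%N by move: qW; rewrite mem0 => /andP[].
  by have := F32 x p mp F32'; rewrite (F32 x q mq F32') xq; case: (chiP x p) => ->.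
have pick A : p \in A -> (1 < #|A|)%N -> exists2 q, q \in A & q != p.
  move=> pA /card_gt1P[a [b [aA bA ab]]]; case: (eqVneq a p) ab => [->|ap _].
    by exists b; rewrite // eq_sym.
  by exists a.
(* Three words through p cut the flat W y0 down to p alone ... *)
have [|q1 q1W q1p] := pick _ p0; first by rewrite c0.
have [y1 Fy1 y1q] := sep _ q1W q1p.
have [fA1 pA1 _ /(_ _ q1W y1q) cA1] := flat_halving y1 fW0 p0.
set A1 := [set r in W y0 | _] in fA1 pA1 cA1.
have e1 : #|A1| = 4%N by apply: double_inj; rewrite -!mul2n cA1 c0.
have [|q2 q2A q2p] := pick _ pA1; first by rewrite e1.
have A1W r : r \in A1 -> r \in W y0 by rewrite inE => /andP[].
have [y2 Fy2 y2q] := sep _ (A1W _ q2A) q2p.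
have [fA2 pA2 _ /(_ _ q2A y2q) cA2] := flat_halving y2 fA1 pA1.
set A2 := [set r in A1 | _] in fA2 pA2 cA2.
have e2 : #|A2| = 2%N by apply: double_inj; rewrite -!mul2n cA2 e1.
have [|q3 q3A q3p] := pick _ pA2; first by rewrite e2.
have A2W r : r \in A2 -> r \in W y0 by rewrite inE => /andP[/A1W].
have [y3 Fy3 y3q] := sep _ (A2W _ q3A) q3p.
have [fA3 pA3 _ /(_ _ q3A y3q) cA3] := flat_halving y3 fA2 pA2.
set A3 := [set r in A2 | _] in fA3 pA3 cA3.
have A3p r : r \in A3 -> r = p.
  have /eqP/cards1P[t A3t] : #|A3| = 1%N by apply: double_inj; rewrite -!mul2n cA3 e2.
  by move: pA3; rewrite A3t !inE => /eqP-> /eqP.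
have [fW1 [c1 p1 mem1 one1 _]] := WP _ Fy1.
have [fW2 [c2 p2 mem2 one2 _]] := WP _ Fy2.
have [fW3 [c3 p3 mem3 one3 _]] := WP _ Fy3.
(* ... but they have a further point p' in common, outside of W y0. *)
have [fB2 pB2 cB2 _] := flat_halving y2 fW1 p1.
have [fB3 pB3 cB3 _] := flat_halving y3 fB2 pB2.
have [|p' p'B p'p] := pick _ pB3.
  move: cB2 cB3; rewrite c1; move: #|_| #|_| => a b; clear; lia.
have [p'1 p'2 p'3] : [/\ p' \in W y1, p' \in W y2 & p' \in W y3].
  move: p'B; rewrite !inE mem2 mem3 => /andP[/andP[p'1 ->] ->].
  by rewrite one1.
have p'0 : p' \notin W y0.
  apply: contra p'p => p'W; apply/eqP/A3p; rewrite !inE p'W.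
  by move: p'1 p'2 p'3; rewrite mem1 mem2 mem3 => /andP[_ ->] /andP[_ ->] /andP[_ ->].
pose u := p + p'.
have [fG cG] : flat (W y0 :|: [set q + u | q in W y0]) /\
    #|W y0 :|: [set q + u | q in W y0]| = (2 * #|W y0|)%N.
  by apply: (flat_double fW0 p0); rewrite /u addKw.
set G := W y0 :|: _ in fG cG; rewrite c0 in cG.
have W_u y q : flat (W y) -> p \in W y -> p' \in W y -> q \in W y -> q + u \in W y.
  by move=> fW pW p'W qW; rewrite /u addrA fW.
pose bad q := [&& q \in W y0, q \notin W y1, q \notin W y2 & q \notin W y3].
have GP r : r \in G -> (0 < m r)%N \/ exists2 q, bad q & r = q + u.
  rewrite inE => /orP[rW|/imsetP[q qW rE]]; first by left; rewrite one0.
  case: (boolP (bad q)) => [|]; first by right; exists q.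
  rewrite /bad qW /= !negb_and !negbK rE => B; left.
  case/or3P: B => qi; [rewrite (one1 (q + u))|rewrite (one2 (q + u))|rewrite (one3 (q + u))] => //;
  exact: W_u.
have bad_uniq q q' : bad q -> bad q' -> q = q'.
  move=> /and4P[qW q1' q2' q3'] /and4P[q'W q'1 q'2 q'3].
  have mq : (0 < m q)%N by rewrite one0.
  have mq' : (0 < m q')%N by rewrite one0.
  have same (y : word d) : chi y q != chi y p -> chi y q' != chi y p -> chi y (p + (q + q')) == chi y p.
    by rewrite !chiD; case: (chiP y p) (chiP y q) (chiP y q') => -> [] -> [] ->.
  apply/eqP; rewrite -addw_eq0; apply/eqP.
  suff /A3p e : p + (q + q') \in A3 by rewrite -(addKw p (q + q')) e addww.
  rewrite 3!inE addrA fW0 //= -addrA.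
  move: q1' q'1 q2' q'2 q3' q'3; rewrite mem1 mem2 mem3 !(mem1, mem2, mem3) mq mq' /=.
  by move=> *; rewrite !same.
exists G; split=> //.
have [/existsP[q0 bq0]|nobad] := boolP [exists q, bad q].
  apply: (@almost_flat _ _ (q0 + u)) => // r /GP[//|[q bq ->]].
  by rewrite (bad_uniq _ _ bq bq0) eqxx.
apply: (@almost_flat _ _ p) => // r /GP[//|[q bq _]].
by case/negP: nobad; apply/existsP; exists q.
Qed.
End ThirtyTwo.

(** * Pairing the columns *)

Section Paired.
Variable d : nat.
Implicit Types (m mu : word d -> nat) (A : {set word d}) (x p q v : word d).
Implicit Types (L : seq (word d * word d)).

(** A pair [(h, v)] stands for the two columns [h] and [h + v]. *)
Definition pairing L m := forall p,
  m p = (count (fun hv => hv.1 == p) L + count (fun hv => (hv.1 + hv.2)%R == p) L)%N.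

(** What it takes for the blocks of constant [v] to come from a generalized
    doubling: the columns [h] of a block generate a doubly even code, and the
    all-one word of a block with [v <> 0] has weight divisible by [8]. *)
Definition balanced L := forall v,
  (forall x, 4 %| count (fun hv => (hv.2 == v) && (dot x hv.1 == 1%R)) L)%N /\
  (v != 0 -> (8 %| count (fun hv => hv.2 == v) L)%N).

Definition paired m := exists2 L, pairing L m & balanced L.

Lemma paired_add m m' : paired m -> paired m' -> paired (fun p => m p + m' p)%N.
Proof.
move=> [L Lm bL] [L' Lm' bL']; exists (L ++ L').
  by move=> p; rewrite !count_cat Lm Lm' addnACA.
move=> v; have [b4 b8] := bL v; have [b4' b8'] := bL' v.
by split=> [x|v0]; rewrite count_cat dvdn_add ?b4 ?b4' ?b8 ?b8'.
Qed.

Lemma eq_paired m m' : m =1 m' -> paired m -> paired m'.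
Proof. by move=> E [L Lm bL]; exists L => // p; rewrite -E. Qed.

Definition block mu v : seq (word d * word d) :=
  flatten [seq nseq (mu p) (p, v) | p <- enum {: word d}].

Lemma count_block (a : pred (word d * word d)) mu v :
  count a (block mu v) = (\sum_p a (p, v) * mu p)%N.
Proof.
rewrite count_flatten -map_comp sumnE big_map big_enum /=.
by apply: eq_bigr => p _; rewrite count_nseq.
Qed.

Lemma block_paired mu v : divisible 4 mu -> (v != 0 -> (8 %| total mu)%N) ->
  paired (fun p => mu p + mu (p + v)%R)%N.
Proof.
move=> mu4 mu8; exists (block mu v) => [p|v'].
  rewrite !count_block /=; congr (_ + _)%N.
    by rewrite (bigD1 p) //= eqxx mul1n big1 ?addn0 // => q /negPf->.
  rewrite (bigD1 (p + v)) //= addwK eqxx mul1n big1 ?addn0 // => q.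
  by rewrite -[X in _ != X]/(p + v) -addw_eq0 addrA addrAC addw_eq0 => /negPf->.
have [<-|vv'] := eqVneq v v'; last first.
  by split=> *; rewrite count_block big1 ?dvdn0 //= => p _; rewrite (negPf vv').
split=> [x|v0]; rewrite count_block /=.
  have := mu4 x; rewrite /wtm big_mkcond; congr (is_true (4 %| _)%N); apply: eq_bigr => p _.
  by rewrite eqxx; case: eqP; rewrite ?mul1n.
have := mu8 v0; congr (is_true (8 %| _)%N); apply: eq_bigr => p _.
by rewrite eqxx mul1n.
Qed.

Lemma even_paired m : divisible 8 m -> oddset m = set0 -> paired m.
Proof.
move=> dm S0; pose mu p := (m p)./2.
have mE p : m p = (mu p + mu p)%N.
  have : p \notin oddset m by rewrite S0 inE.
  by rewrite inE /mu addnn => /negbTE o; rewrite -[LHS]odd_double_half o.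
apply: (eq_paired (m := fun p => mu p + mu (p + 0)%R)%N) => [p|].
  by rewrite addr0 -mE.
apply: block_paired; last by rewrite eqxx.
move=> x; have := dm x; rewrite /wtm (eq_bigr _ (fun p _ => mE p)) big_split /=.
lia.
Qed.

(** The first halves are the columns seen by a codeword [y] with [y.v = 1]. *)
Lemma invariant_paired m v : divisible 8 m -> v != 0 ->
  (forall p, m (p + v) = m p) -> paired m.
Proof.
move=> dm v0 inv; have [y yv] := dot_nondegenerate v0.
pose mu p := (((dot y p == 1%R) == true) * m p)%N.
apply: (eq_paired (m := fun p => mu p + mu (p + v)%R)%N) => [p|].
  by rewrite /mu dotDr yv inv; case: (F2P (dot y p)) => -> //=; rewrite mul1n ?addn0.
apply: block_paired; first exact: divisible_section.
move=> _; have := dm y; rewrite /wtm big_mkcond; congr (is_true (8 %| _)%N).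
by apply: eq_bigr => p _; rewrite /mu; case: eqP => _; rewrite ?mul1n.
Qed.

Lemma flat_paired G : flat G -> #|G| = 16%N -> paired (ind G).
Proof.
move=> fG cG; have /card_gt1P[p [q [pG qG pq]]] : (1 < #|G|)%N by rewrite cG.
apply: (invariant_paired (v := p + q)); rewrite ?addw_eq0 //.
  exact: flat_divisible.
have fpq t : t \in G -> t + (p + q) \in G by move=> tG; rewrite addrA fG.
move=> r; rewrite /ind; congr nat_of_bool; apply/idP/idP => [/fpq|/fpq//].
by rewrite addwK.
Qed.

Lemma split_paired m m' : divisible 8 m -> divisible 8 m' ->
  (forall p, m' p <= m p)%N -> paired m' ->
  (divisible 8 (fun p => m p - m' p)%N -> paired (fun p => m p - m' p)%N) ->
  paired m.
Proof.
move=> dm dm' le pm' pr; apply: eq_paired (fun p => esym (subKm le p)) _.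
by apply: paired_add => //; apply: pr; apply: divisible_sub.
Qed.

Lemma oddset16_paired m : divisible 8 m -> ~~ odd (total m) ->
  #|oddset m| = 16%N -> paired m.
Proof.
move=> dm tm s16; have fS := oddset16_flat dm tm s16.
apply: (split_paired (m' := ind (oddset m))) => //; first exact: flat_divisible.
- by move=> p; rewrite /ind inE; case: (m p) => // k; case: (odd _).
- exact: flat_paired.
move=> dr; apply: even_paired => //; apply/setP=> p; rewrite !inE /ind inE.
by case: (m p) => // k; case o : (odd k.+1); rewrite ?subn0 ?o //= subn1 /=; move: o => /= /negbTE.
Qed.

Lemma heavy_paired m p : divisible 8 m -> (8 <= m p)%N ->
  (forall m' : word d -> nat, divisible 8 m' -> total m' = (total m - 8)%N -> paired m') ->
  paired m.
Proof.
move=> dm mp pr; have le q : (8 * ind [set p] q <= m q)%N.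
  by rewrite /ind inE; case: eqP => [->|]; rewrite ?muln0 ?muln1.
apply: (split_paired (m' := fun q => 8 * ind [set p] q)%N) => //.
- exact: divisible_point.
- apply: even_paired; first exact: divisible_point.
  by apply/setP=> q; rewrite !inE oddM.
by move=> dr; apply: pr; rewrite // total_sub // total_point.
Qed.

Lemma paired16 m : divisible 8 m -> (total m <= 16)%N -> ~~ odd (total m) -> paired m.
Proof.
move=> dm tm em; have := total_half m; have [e|e|e|e] := oddset_div8 dm em.
- by move=> _; apply: even_paired => //; apply/eqP; rewrite -cards_eq0 e.
- by move=> _; apply: oddset16_paired.
- by rewrite e; lia.
- by move: e; move: #|_| => s; lia.
Qed.

Lemma paired24 m : divisible 8 m -> total m = 24%N -> paired m.
Proof.
move=> dm tm; have [S0|/(heavy24 dm tm)[p mp]] := eqVneq (oddset m) set0.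
  exact: even_paired.
by apply: heavy_paired mp _ => // m' dm'; rewrite tm => tm'; apply: paired16; rewrite ?tm'.
Qed.

Lemma paired32 m : divisible 8 m -> total m = 32%N -> paired m.
Proof.
move=> dm tm; have [S0|[v v0 inv]|[G [fG cG le]]] := length32 dm tm.
- exact: even_paired.
- exact: invariant_paired inv.
apply: (split_paired (m' := ind G)) => //; [exact: flat_divisible|exact: flat_paired|].
by move=> dr; apply: paired16; rewrite ?total_sub // total_ind tm cG.
Qed.

(** Flats of size [16] and columns of multiplicity [8] are split off until the
    odd part is empty or a translation preserves the columns. *)
Theorem divisible_paired m : divisible 8 m -> (8 %| total m)%N -> (total m <= 40)%N ->
  paired m.
Proof.
move=> dm t8 t40.
have : (total m <= 16 \/ total m = 24 \/ total m = 32 \/ total m = 40)%N by lia.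
case=> [t16|[t|[t|t]]]; last 1 first.
- have [e|e|[p mp]] := heavy40 dm t.
  + by apply: even_paired => //; apply/eqP; rewrite -cards_eq0 e.
  + by apply: oddset16_paired; rewrite // t.
  by apply: heavy_paired mp _ => // m' dm'; rewrite t => t'; apply: paired32.
- by apply: paired16 => //; lia.
- exact: paired24.
exact: paired32.
Qed.

End Paired.

(** * Doubly even codes *)

Section Words.
Variable n : nat.
Implicit Types (x y z u v w : word n) (C D K : code n) (J : {set 'I_n}).

Definition overlap u v : nat := #|supp u :&: supp v|.

Lemma supp_row x i : (i \in supp x)%:R = x 0 i.
Proof. by rewrite inE; case: (F2P (x 0 i)) => ->. Qed.

Lemma supp_inj : injective (@supp n).
Proof. by move=> x y e; apply/rowP=> i; rewrite -!supp_row e. Qed.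

Lemma card_sum (A : {set 'I_n}) : #|A| = (\sum_i (i \in A))%N.
Proof. by rewrite -sum1_card big_mkcond; apply: eq_bigr => i _; case: (i \in A). Qed.

Lemma wtD x y : (wt (x + y) + 2 * overlap x y = wt x + wt y)%N.
Proof.
rewrite /wt /overlap !card_sum big_distrr -!big_split; apply: eq_bigr => i _ /=.
by rewrite !inE mxE; case: (F2P (x 0 i)) (F2P (y 0 i)) => -> [] ->.
Qed.

Lemma overlapC x y : overlap x y = overlap y x.
Proof. by rewrite /overlap setIC. Qed.

Lemma overlapD x y z : (overlap (x + y) z + 2 * #|supp x :&: supp y :&: supp z| =
  overlap x z + overlap y z)%N.
Proof.
rewrite /overlap !card_sum big_distrr -!big_split; apply: eq_bigr => i _ /=.
rewrite !inE mxE; case: (z 0 i == 1); rewrite ?andbF //.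
by case: (F2P (x 0 i)) (F2P (y 0 i)) => -> [] ->.
Qed.

Lemma dot_overlap x y : dot x y = (overlap x y)%:R.
Proof.
rewrite /overlap card_sum natr_sum; apply: eq_bigr => i _; rewrite !inE.
by case: (F2P (x 0 i)) (F2P (y 0 i)) => -> [] ->; apply/val_inj.
Qed.

Lemma F2_natr_eq0 k : (k%:R == 0 :> 'F_2) = ~~ odd k.
Proof.
rewrite -[in LHS](odd_double_half k) -mul2n natrD natrM.
by have -> : 2%:R = 0 :> 'F_2; [apply/val_inj | rewrite mul0r addr0; case: odd].
Qed.

Lemma dot_eq0 x y : (dot x y == 0) = ~~ odd (overlap x y).
Proof. by rewrite dot_overlap F2_natr_eq0. Qed.

Lemma wt0 : wt (0 : word n) = 0%N.
Proof. by apply/eqP; rewrite cards_eq0; apply/eqP/setP=> i; rewrite !inE mxE. Qed.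

(** Over a field of two elements this is all it takes to be a code. *)
Definition sum_closed (P : pred (word n)) := P 0 /\ forall x y, P x -> P y -> P (x + y).

Lemma span_closed (P : pred (word n)) (X : seq (word n)) :
  sum_closed P -> {in X, forall x, P x} -> forall x, x \in <<X>>%VS -> P x.
Proof.
move=> [P0 PD] PX x xX; rewrite (coord_span (X := in_tuple X) xX).
apply: (big_ind P) => // i _.
case: (F2P (coord (in_tuple X) i x)) => ->; rewrite ?scale0r ?scale1r //.
by apply: PX; apply: mem_nth.
Qed.

Definition code_of (P : pred (word n)) : code n := <<enum P>>%VS.

Lemma mem_code_of (P : pred (word n)) x : sum_closed P -> (x \in code_of P) = P x.
Proof.
move=> PP; apply/idP/idP => [|Px]; last by apply: memv_span; rewrite mem_enum.
by apply: span_closed => // y; rewrite mem_enum.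
Qed.

Lemma doubly_even_overlap C x y : doubly_even C -> x \in C -> y \in C -> ~~ odd (overlap x y).
Proof.
move=> dC xC yC; have xyC : x + y \in C by apply: rpredD.
move: (wtD x y) (dC _ xC) (dC _ yC) (dC _ xyC).
by move: (wt x) (wt y) (wt (x + y)) (overlap x y) => a b c k; clear; lia.
Qed.

Lemma doubly_even_dot C x y : doubly_even C -> x \in C -> y \in C -> dot x y = 0.
Proof. by move=> dC xC yC; apply/eqP; rewrite dot_eq0; apply: doubly_even_overlap dC _ _. Qed.

Definition res J x : word n := \row_i (if i \in J then x 0 i else 0).

Lemma resD J x y : res J (x + y) = res J x + res J y.
Proof. by apply/rowP=> i; rewrite !mxE; case: ifP; rewrite ?addr0. Qed.

Lemma res0 J : res J 0 = 0.
Proof. by apply/rowP=> i; rewrite !mxE; case: ifP. Qed.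

Lemma supp_res J x : supp (res J x) = supp x :&: J.
Proof.
by apply/setP=> i; rewrite !inE mxE; case: (i \in J); rewrite ?andbT ?andbF.
Qed.

Lemma res_id J x : supp x \subset J -> res J x = x.
Proof. by move=> /setIidPl e; apply: supp_inj; rewrite supp_res e. Qed.

Lemma overlap_res J x y : overlap (res J x) y = overlap x (res J y).
Proof. by rewrite /overlap !supp_res setIAC setIA. Qed.

Definition char_word J : word n := \row_i (i \in J)%:R.

Lemma supp_char J : supp (char_word J) = J.
Proof. by apply/setP=> i; rewrite inE mxE; case: (i \in J). Qed.

Lemma overlap_char J x : overlap (char_word J) x = wt (res J x).
Proof. by rewrite /overlap /wt supp_char supp_res setIC. Qed.

(** ** Maximal doubly even codes in length divisible by [8] *)

(** The real part of the [k]-th power of the imaginary unit. *)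
Definition c4 (k : nat) : int :=
  if (4 %| k)%N then 1 else if odd k then 0 else -1.

Lemma c4_shift x y : (4 %| wt y)%N -> c4 (wt (x + y)) = c4 (wt x) * chi x y.
Proof.
move=> y4; rewrite /chi dot_eq0; have := wtD x y; move: y4.
move: (wt x) (wt y) (wt (x + y)) (overlap x y) => a b c k b4 E; rewrite /c4.
by do ![case: ifP => ?]; lia.
Qed.

Lemma c4_total J : #|J| \in [:: 0; 8; 16]%N -> 0 < \sum_(y | supp y \subset J) c4 (wt y).
Proof.
move=> J8.
have -> : \sum_(y | supp y \subset J) c4 (wt y) = \sum_(k < #|J|.+1) c4 k *+ 'C(#|J|, k).
  rewrite (partition_big (fun y => inord (wt y) : 'I_#|J|.+1) xpredT) //=.
  apply: eq_bigr => k _; rewrite -cards_draws -sumr_const.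
  rewrite (reindex_onto (@supp n) (@char_word)) /=; last by move=> A _; apply: supp_char.
  apply: eq_big => [y|y].
    rewrite inE (_ : char_word (supp y) = y) ?eqxx ?andbT; last by apply: supp_inj; rewrite supp_char.
    case sJ : (supp y \subset J) => //=; rewrite -val_eqE /= inordK //.
    by rewrite ltnS subset_leq_card.
  by move=> /andP[/subset_leq_card sJ /eqP <-]; rewrite inordK.
move: J8; rewrite !inE => /or3P[]/eqP->; rewrite !big_ord_recl big_ord0 /=; by vm_compute.
Qed.

(** Sum [c4 (wt y)] over all words [y].  Translation by a word of the code changes
    the sign of this term when [y] is not orthogonal to it, so that only the dual
    code contributes to the total, which is positive.  If the dual were larger
    than the code, at least half of its words would contribute [-1], since by
    maximality their weights are [2] modulo [4]. *)
Lemma maximal_self_dual J K : #|J| \in [:: 0; 8; 16]%N ->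
  (forall c, c \in K -> supp c \subset J /\ (4 %| wt c)%N) ->
  (forall z, supp z \subset J -> (forall c, c \in K -> dot z c = 0) ->
     (4 %| wt z)%N -> z \in K) ->
  forall z, supp z \subset J -> (forall c, c \in K -> dot z c = 0) -> z \in K.
Proof.
move=> J8 KJ maxK z zJ zK; apply: contraT => zNK.
pose P y := supp y \subset J; pose perp y := [forall c, (c \in K) ==> (dot y c == 0)].
have perpP y : reflect (forall c, c \in K -> dot y c = 0) (perp y).
  by apply: (iffP forallP) => H c; have := H c; [move/implyP=> h /h/eqP | move=> h; apply/implyP=> /h->].
have PD x c : c \in K -> P (x + c) = P x.
  move=> cK; have cJ := (KJ _ cK).1.
  have sub u v : P u -> P v -> P (u + v).
    move=> /subsetP uJ /subsetP vJ; apply/subsetP=> i; rewrite inE mxE => uv.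
    case iu : (i \in supp u); first exact: uJ.
    by apply: vJ; move: iu uv; rewrite !inE; case: (F2P (u 0 i)) => ->; rewrite ?add0r.
  by apply/idP/idP => [/sub/(_ cJ)|/sub->//]; rewrite addwK.
have K0 : 0 < (\sum_(c in K) 1 : int).
  by rewrite (bigD1 0) ?mem0v //= ltr_wpDr // sumr_ge0.
have dual : (\sum_(c in K) 1) * (\sum_(y | P y) c4 (wt y)) =
    (\sum_(c in K) 1) * \sum_(y | P y && perp y) c4 (wt y).
  have -> : (\sum_(c in K) 1) * (\sum_(y | P y) c4 (wt y)) =
      \sum_(c in K) \sum_(y | P y) c4 (wt y) * chi y c.
    rewrite mulr_suml; apply: eq_bigr => c cK; rewrite mul1r.
    rewrite (reindex_inj (@addw_inj _ c)) /=.
    by apply: eq_big => [y|y _]; [exact: PD | rewrite c4_shift // (KJ _ cK).2].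
  rewrite exchange_big big_mkcondr mulr_sumr /=; apply: eq_bigr => y _.
  rewrite -mulr_sumr; case: (perpP y) => [yK|].
    by rewrite mulrC; congr (_ * _); apply: eq_bigr => c /yK yc; rewrite /chi yc.
  move=> nperp; rewrite mulr0.
  have [c0 c0K yc0] : exists2 c, c \in K & dot y c != 0.
    have : ~~ perp y by apply/(perpP y).
    by rewrite negb_forall => /existsP[c]; rewrite negb_imply => /andP[]; exists c.
  suff -> : \sum_(c in K) chi y c = 0 by rewrite mulr0.
  suff : \sum_(c in K) chi y c = - \sum_(c in K) chi y c by lia.
  rewrite -{1}[RHS]mulN1r mulr_sumr [LHS](reindex_inj (@addw_inj _ c0)) /=.
  apply: eq_big => [c|c _]; first by rewrite rpredDr.
  by rewrite chiD mulrC {1}/chi (negPf yc0).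
have := c4_total J8; move/(mulfI (lt0r_neq0 K0)): dual => ->.
have one : char_word J \in K.
  have e c : c \in K -> res J c = c by move=> /KJ[cJ _]; apply: res_id.
  have J4 : (4 %| #|J|)%N by move: J8; rewrite !inE => /or3P[]/eqP->.
  apply: maxK; rewrite ?supp_char // /wt ?supp_char // => c cK.
  apply/eqP; rewrite dot_eq0 overlap_char e //; have := (KJ _ cK).2; lia.
have out y : P y -> perp y -> c4 (wt y) = (if y \in K then 1 else -1).
  move=> yJ /perpP yK; case: ifPn => [/KJ[_ y4]|yNK]; first by rewrite /c4 y4.
  rewrite /c4; case: ifP => [y4|_].
    by case/negP: yNK; apply: maxK.
  have := yK _ one; move/eqP; rewrite dot_eq0 overlapC overlap_char res_id //.
  by move=> /negbTE->.
rewrite (eq_bigr (fun y => if y \in K then 1 else -1)); last by move=> y /andP[]; apply: out.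
rewrite (bigID (mem K)) /=.
have -> : \sum_(y | P y && perp y && (y \in K)) (if y \in K then 1 else -1) =
    \sum_(y in K) (1 : int).
  apply: eq_big => [y|y /andP[_ ->] //]; case yK : (y \in K); rewrite ?andbF // andbT.
  rewrite /P (KJ _ yK).1; apply/perpP=> c cK.
  by apply: (doubly_even_dot (C := K)) => // u /KJ[].
have : \sum_(c in K) (1 : int) <= \sum_(y | P y && perp y && (y \notin K)) 1.
  rewrite (reindex_inj (@addw_inj _ z)) /= big_mkcond [leRHS]big_mkcond.
  apply: ler_sum => y _; case: ifP => [yzK|_]; last by case: ifP.
  have yE : y = z + (y + z) by rewrite addrC addwK.
  rewrite {1}yE PD // {1}/P zJ /=.
  have -> : perp y.
    apply/perpP => c cK; rewrite yE dotDl zK // add0r.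
    by apply: (doubly_even_dot (C := K)) => // u /KJ[].
  case yK : (y \in K) => //=; case/negP: zNK.
  by rewrite -(addKw y z); apply: rpredD.
have -> : \sum_(y | P y && perp y && (y \notin K)) (if y \in K then 1 else -1) =
    - \sum_(y | P y && perp y && (y \notin K)) (1 : int).
  by rewrite -sumrN; apply: eq_bigr => y /andP[_ /negPf->].
by move: (bigop _ _ _) (bigop _ _ _) => a b; clear; lia.
Qed.

End Words.

Section Blocks.
Variables (n : nat) (I : finType) (i0 : I) (lab : 'I_n -> I).
Let J v : {set 'I_n} := [set j | lab j == v].
Implicit Types (x y z : word n) (C D E : code n).

Lemma res_block v v' x : res (J v) (res (J v') x) = if v == v' then res (J v) x else 0.
Proof.
apply/rowP=> i; case: (eqVneq v v') => [<-|vv']; rewrite !mxE !inE.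
  by case: eqP.
by case: (eqVneq (lab i) v) => [->|//]; rewrite (negPf vv').
Qed.

Lemma sum_blocks x : \sum_v res (J v) x = x.
Proof.
apply/rowP=> i; rewrite summxE (bigD1 (lab i)) //= big1 ?addr0.
  by rewrite mxE inE eqxx.
by move=> v vi; rewrite mxE inE eq_sym (negPf vi).
Qed.

Lemma overlap_blocks x y : overlap x y = (\sum_v overlap (res (J v) x) y)%N.
Proof.
rewrite /overlap card_sum; under [RHS]eq_bigr do rewrite card_sum.
rewrite exchange_big; apply: eq_bigr => i _ /=.
rewrite (bigD1 (lab i)) //= big1 ?addn0.
  by rewrite supp_res !inE eqxx andbT.
by move=> v vi; rewrite supp_res !inE (eq_sym (lab i)) (negPf vi) andbF.
Qed.

Lemma wt_blocks x : wt x = (\sum_v wt (res (J v) x))%N.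
Proof.
have -> : wt x = overlap x x by rewrite /overlap setIid.
by rewrite overlap_blocks; apply: eq_bigr => v _; rewrite /overlap /wt supp_res setIAC setIid.
Qed.

Definition blockwise C := [forall x : word n, (x \in C) ==>
  (4 %| wt x)%N && [forall v, res (J v) x \in C]].

Lemma blockwiseP C : reflect (doubly_even C /\ forall x v, x \in C -> res (J v) x \in C)
  (blockwise C).
Proof.
apply: (iffP forallP) => [H|[H1 H2] x].
  split=> x; first by move=> xC; have := H x; rewrite xC /= => /andP[].
  by move=> v xC; have := H x; rewrite xC /= => /andP[_ /forallP/(_ v)].
by apply/implyP=> xC; rewrite H1 //=; apply/forallP=> v; apply: H2.
Qed.

Lemma maximal_blockwise C : blockwise C ->
  exists D, [/\ (C <= D)%VS, blockwise D &
    forall y, blockwise (D + <[y]>)%VS -> y \in D].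
Proof.
move: {2}(n - \dim C)%N (leqnn (n - \dim C)) => k.
elim: k C => [|k IH] C le bC;
  (have [/existsP[y /andP[yNC yC]]|H] :=
    boolP [exists y, (y \notin C) && blockwise (C + <[y]>)%VS]; last by
    exists C; split=> // y yC; apply: contraNT H => yNC; apply/existsP;
    exists y; rewrite yNC).
all: have lt : (\dim C < \dim (C + <[y]>)%VS)%N by
  rewrite ltn_neqAle dimvS ?addvSl // andbT; apply: contra yNC => /eqP e;
  have /eqP -> : C == (C + <[y]>)%VS; [by rewrite eqEdim addvSl e leqnn | 
  by rewrite memvE addvSr].
all: have dn : (\dim (C + <[y]>)%VS <= n)%N by
  rewrite (leq_trans (dimvS (subvf _))) // dimvf /dim /= mul1n.
  by move: lt dn le; move: (\dim C) (\dim _) => a b; clear; lia.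
have [|D [CD bD mD]] := IH (C + <[y]>)%VS _ yC.
  by move: lt dn le; move: (\dim C) (\dim _) => a b; clear; lia.
by exists D; split=> //; apply: subv_trans CD; apply: addvSl.
Qed.

Lemma blockwise_extend D z : blockwise D -> (forall c, c \in D -> dot z c = 0) ->
  (4 %| wt z)%N -> (forall v, res (J v) z = z \/ res (J v) z = 0) ->
  blockwise (D + <[z]>)%VS.
Proof.
move=> /blockwiseP[dD rD] zD z4 rz; apply/blockwiseP.
have memD c : c \in (D + <[z]>)%VS -> exists2 e, e \in D & c = e \/ c = e + z.
  case/memv_addP=> e eD [_ /vlineP[a ->] ->]; exists e => //.
  by case: (F2P a) => ->; rewrite ?scale0r ?scale1r ?addr0; [left|right].
have inD e : e \in D -> e \in (D + <[z]>)%VS by apply/subvP/addvSl.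
have zz : z \in (D + <[z]>)%VS by rewrite memvE addvSr.
split=> [c /memD[e eD [->|->]]|c v /memD[e eD [->|->]]].
- exact: dD.
- have := zD _ eD; move/eqP; rewrite dot_eq0 overlapC; have := dD _ eD; have := wtD e z.
  by move: z4; move: (wt _) (wt _) (wt _) (overlap _ _) => a b c1 k; clear; lia.
- by apply/inD/rD.
by rewrite resD; apply: rpredD; [apply/inD/rD | case: (rz v) => ->; rewrite ?mem0v].
Qed.

(** On the blocks of length divisible by [8] the code is self-dual, so that it
    contains the restrictions to them of any word [y] of a larger doubly even
    code; what is left of [y] lives on a single block. *)
Lemma blockwise_maximal D : (forall v, v != i0 -> #|J v| \in [:: 0; 8; 16]%N) ->
  blockwise D -> (forall y, blockwise (D + <[y]>)%VS -> y \in D) ->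
  maximal_doubly_even D.
Proof.
move=> J8 bD mD; have /blockwiseP[dD rD] := bD; split=> // E dE DE.
have DinE c : c \in D -> c \in E by apply/subvP.
apply/eqP; rewrite eqEsubv DE andbT; apply/subvP=> y yE.
have block v : v != i0 -> res (J v) y \in D.
  move=> v0; pose P := [pred c | (c \in D) && (supp c \subset J v)].
  have PP : sum_closed P.
    split=> [|a b /andP[aD aJ] /andP[bD' bJ]]; apply/andP; split; rewrite ?mem0v ?rpredD //.
      by apply/subsetP=> i; rewrite inE mxE.
    by rewrite -(res_id aJ) -(res_id bJ) -resD supp_res subsetIr.
  have KP c : (c \in code_of P) = P c by apply: mem_code_of.
  suff : res (J v) y \in code_of P by rewrite KP => /andP[].
  apply: maximal_self_dual (J8 _ v0) _ _ _ _ _.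
  - by move=> c; rewrite KP => /andP[cD cJ]; split; last exact: dD.
  - move=> z zJ zK z4; rewrite KP /= zJ andbT; apply/mD/blockwise_extend => // [c cD|v'].
      rewrite -(res_id zJ); apply/eqP; rewrite dot_eq0 overlap_res -dot_eq0; apply/eqP.
      by apply: zK; rewrite KP /= rD // supp_res subsetIr.
    rewrite -(res_id zJ) res_block; case: eqP => [->|_]; [left|right] => //.
  - by rewrite supp_res subsetIr.
  move=> c; rewrite KP => /andP[cD cJ]; apply/eqP.
  rewrite dot_eq0 overlap_res (res_id cJ) -dot_eq0; apply/eqP.
  by apply: doubly_even_dot dE _ _ => //; apply: DinE.
have y0E : res (J i0) y \in E.
  have := sum_blocks y; rewrite (bigD1 i0) //= => /(canRL (addrK _)) ->.
  by rewrite rpredB //; apply: rpred_sum => v v0; apply/DinE/block.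
rewrite -(sum_blocks y) rpred_sum // => v _; have [->|v0] := eqVneq v i0; last exact: block.
apply/mD/blockwise_extend => // [c cD||v'].
- by apply: doubly_even_dot dE _ _ => //; apply: DinE.
- exact: dE.
by rewrite res_block; case: eqP => [->|_]; [left|right].
Qed.

End Blocks.

(** * Doublings *)

Section Doubling.
Variables (n : nat) (C : code n).
Hypothesis dC : doubly_even C.
Implicit Types (x y r : word n).

Lemma wt_star x y : wt (star x y) = overlap x y.
Proof.
rewrite /wt /overlap; apply: eq_card => i; rewrite inE mxE.
by case: (i \in _).
Qed.

Lemma RadC_P r : r \in C ->
  reflect ((forall x, x \in C -> 4 %| overlap x r)%N /\ (8 %| wt r)%N) (r \in RadC C).
Proof.
move=> rC; rewrite !inE; apply: (iffP andP) => [[/andP[_ /forallP H] r8]|[H r8]].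
  split=> // x xC; have := H x; rewrite xC /B wt_star F2_natr_eq0 /=.
  by have := doubly_even_overlap dC xC rC; move: (overlap x r) => k; clear; lia.
split=> //; apply/andP; split; apply/forallP=> x; apply/implyP=> xC.
  by apply/eqP/(doubly_even_dot dC).
rewrite /B wt_star F2_natr_eq0; have := H _ xC.
by move: (overlap x r) => k; clear; lia.
Qed.

(** Although [B] is not bilinear: applying the hypothesis on [r] to [x + r'] shows
    that [r], [r'] and [x] have an even triple intersection. *)
Lemma RadC_add r r' : r \in C -> r' \in C -> r \in RadC C -> r' \in RadC C ->
  r + r' \in RadC C.
Proof.
move=> rC r'C /(RadC_P rC)[Hr r8] /(RadC_P r'C)[Hr' r'8].
have rrC : r + r' \in C by apply: rpredD.
apply/(RadC_P rrC); split=> [x xC|]; last first.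
  have := wtD r r'; have := Hr' _ rC; move: r8 r'8.
  by move: (wt _) (wt _) (wt _) (overlap _ _) => a b c k; clear; lia.
have xrC : x + r' \in C by apply: rpredD.
have := overlapD x r' r; rewrite -setIA [supp r' :&: _]setIC setIA.
have := overlapD r r' x; rewrite -setIA [supp r' :&: _]setIC setIA [supp r :&: supp x]setIC.
rewrite !(overlapC _ x); move: (Hr _ xC) (Hr' _ xC) (Hr _ xrC) (Hr _ r'C).
move: (overlap _ _) (overlap _ _) (overlap _ _) (overlap _ _) (overlap _ _) #|_| => a b c e f k.
by clear; lia.
Qed.

Lemma wt_row_mx m1 m2 (x : word m1) (y : word m2) : wt (row_mx x y) = (wt x + wt y)%N.
Proof.
rewrite /wt !card_sum big_split_ord /=; congr (_ + _)%N; apply: eq_bigr => i _.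
  by rewrite !inE row_mxEl.
by rewrite !inE row_mxEr.
Qed.

Lemma doubling_triply_even : triply_even (gen_doubling C).
Proof.
pose P (w : word (n + n)) := [exists x : word n, exists r : word n,
  [&& x \in C, r \in C, r \in RadC C & w == row_mx (x + r) x]].
have P1 x r : x \in C -> r \in C -> r \in RadC C -> P (row_mx (x + r) x).
  by move=> xC rC rR; apply/existsP; exists x; apply/existsP; exists r; rewrite xC rC rR eqxx.
have R0 : 0 \in RadC C.
  apply/(RadC_P (mem0v C)); split=> [x _|]; last by rewrite wt0.
  by rewrite /overlap (_ : supp 0 = set0) ?setI0 ?cards0 //; apply/setP=> i; rewrite !inE mxE.
have PP : sum_closed P.
  split; first by rewrite -(row_mx0 _ 1 n n) -[X in row_mx X]addr0; apply: P1; rewrite ?mem0v.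
  move=> a b /existsP[x /existsP[r /and4P[xC rC rR /eqP->]]].
  move=> /existsP[x' /existsP[r' /and4P[xC' rC' rR' /eqP->]]].
  by rewrite add_row_mx addrACA; apply: P1; rewrite ?rpredD ?RadC_add.
move=> w wD; suff /existsP[x /existsP[r /and4P[xC rC /(RadC_P rC)[Hr r8] /eqP->]]] : P w.
  rewrite wt_row_mx; have := wtD x r; have := Hr _ xC; have := dC xC; move: r8.
  by move: (wt _) (wt _) (wt _) (overlap _ _) => a b c k; clear; lia.
apply: span_closed PP _ _ wD => y; rewrite mem_cat => /orP[]/imageP[x xC ->].
  case/andP: xC => xC xR; rewrite -[x in row_mx x]add0r; apply: P1; rewrite ?mem0v //.
by rewrite -[X in row_mx X]addr0; apply: P1; rewrite ?mem0v.
Qed.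

End Doubling.

(** * Columns of a code *)

Section Columns.
Variables (N k : nat) (col : 'I_N -> word k).

Definition codeword (x : word k) : word N := \row_i dot x (col i).
Definition column_mult (p : word k) : nat := #|[set i | col i == p]|.

Lemma codewordD x y : codeword (x + y) = codeword x + codeword y.
Proof. by apply/rowP=> i; rewrite !mxE dotDl. Qed.

Lemma codeword0 : codeword 0 = 0.
Proof. by apply/rowP=> i; rewrite !mxE dotC dot0r. Qed.

Lemma sum_column_mult (P : pred (word k)) :
  (\sum_(p | P p) column_mult p = #|[set i | P (col i)]|)%N.
Proof.
rewrite -sum1dep_card (partition_big col P) //=; apply: eq_bigr => p Pp.
rewrite /column_mult -sum1dep_card; apply: eq_bigl => i.
by case: eqP => [->|]; rewrite ?Pp ?andbF.
Qed.

Lemma wt_codeword x : wt (codeword x) = wtm column_mult x.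
Proof.
by rewrite /wtm sum_column_mult; apply: eq_card => i; rewrite !inE mxE.
Qed.

Lemma total_column_mult : total column_mult = N.
Proof.
rewrite /total sum_column_mult -[RHS]card_ord; apply: eq_card => i.
by rewrite !inE.
Qed.

End Columns.

Lemma code_columns N (T : code N) : exists k (col : 'I_N -> word k),
  forall t, t \in T <-> exists x, t = codeword col x.
Proof.
exists (\dim T), (fun i => \row_j (vbasis T)`_j 0 i) => t.
have E x : codeword (fun i => \row_j (vbasis T)`_j 0 i) x = \sum_j x 0 j *: (vbasis T)`_j.
  by apply/rowP=> i; rewrite mxE summxE; apply: eq_bigr => j _; rewrite !mxE.
split=> [/coord_vbasis e|[x ->]].
  exists (\row_j coord (vbasis T) j t); rewrite E {1}e.
  by apply: eq_bigr => j _; rewrite mxE.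
rewrite E; apply: memv_suml => j _; apply/memvZ/vbasis_mem/mem_nth.
by rewrite size_tuple.
Qed.

Lemma pairing_perm n k (col : 'I_(n + n) -> word k) L : pairing L (column_mult col) ->
  exists s : 'S_(n + n), size L = n /\ forall x, col_perm s (codeword col x) =
    row_mx (codeword (fun j : 'I_n => (nth (0, 0) L j).1) x)
      (codeword (fun j : 'I_n => (nth (0, 0) L j).1 + (nth (0, 0) L j).2) x).
Proof.
move=> Lm; pose l := map fst L ++ map (fun hv => hv.1 + hv.2) L.
have perm_l : perm_eq [seq col i | i <- enum 'I_(n + n)] l.
  apply/allP => p _ /=; apply/eqP; rewrite count_cat !count_map.
  rewrite -[RHS]/(count (fun hv => hv.1 == p) L + count (fun hv => (hv.1 + hv.2)%R == p) L)%N.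
  by rewrite -Lm /column_mult cardsE cardE /enum_mem size_filter -enumT; apply: eq_count => i.
have szL : size L = n.
  by have := perm_size perm_l; rewrite /l size_cat !size_map -enumT size_enum_ord !addnn => /double_inj ->.
have szl : size l == (n + n)%N by rewrite size_cat !size_map szL.
have [p pE] := elimT (tuple_permP (t := Tuple szl)) perm_l.
have colE i : col i = nth 0 l (p i).
  have := congr1 (fun r => nth 0 r i) pE.
  rewrite (nth_map i) ?size_enum_ord // nth_ord_enum => ->.
  by rewrite -tnth_nth tnth_mktuple (tnth_nth 0).
exists (p^-1)%g; split=> // x; apply/rowP=> i.
case: (split_ordP i) => j ->; rewrite (row_mxEl, row_mxEr) !mxE colE permKV /l.
  by rewrite nth_cat size_map szL /= ltn_ord (nth_map (0, 0)) ?szL.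
by rewrite nth_cat size_map szL /= ltnNge leq_addr /= addKn (nth_map (0, 0)) ?szL.
Qed.

Section Assembly.
Variables (n k : nat) (L : seq (word k * word k)).
Hypotheses (szL : size L = n) (n20 : (n <= 20)%N) (bL : balanced L).
Let h (j : 'I_n) := (nth (0, 0) L j).1.
Let lab (j : 'I_n) := (nth (0, 0) L j).2.
Let J v : {set 'I_n} := [set j | lab j == v].

Lemma count_label (a : pred (word k * word k)) :
  count a L = #|[set j : 'I_n | a (h j, lab j)]|.
Proof.
rewrite -sum1dep_card -sum1_count (big_nth (0, 0)) szL big_mkord.
by apply: eq_bigl => j; rewrite /h /lab -surjective_pairing.
Qed.

(** The code [D] consists of the words that agree on each block with some word of
    the code of the first halves. *)
Lemma blockwise_cover : exists D : code n, blockwise lab D /\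
  forall x, codeword h x \in D.
Proof.
pose P (c : word n) := [forall v, exists x, res (J v) c == res (J v) (codeword h x)].
have PP : sum_closed P.
  split; first by apply/forallP=> v; apply/existsP; exists 0; rewrite codeword0.
  move=> a b /forallP Pa /forallP Pb; apply/forallP=> v; apply/existsP.
  have /existsP[x /eqP ex] := Pa v; have /existsP[y /eqP ey] := Pb v.
  by exists (x + y); rewrite codewordD !resD ex ey.
exists (code_of P); split; last first.
  by move=> x; rewrite mem_code_of //; apply/forallP=> v; apply/existsP; exists x.
apply/blockwiseP; split=> c => [|v]; rewrite !mem_code_of // => /forallP Pc; last first.
  apply/forallP=> v'; rewrite res_block; apply/existsP; have /existsP[x /eqP ex] := Pc v'.
  by case: eqP => _; [exists x; rewrite ex | exists 0; rewrite codeword0 res0].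
rewrite (wt_blocks lab); apply: dvdn_sum => v _; have /existsP[x /eqP ->] := Pc v.
have := (bL v).1 x; rewrite count_label /wt supp_res; congr (is_true (4 %| _)%N).
by apply: eq_card => j; rewrite !inE mxE andbC.
Qed.

(** The two halves of a codeword differ by a sum [w] of all-one words of blocks
    with [v <> 0], and such words lie in the radical. *)
Lemma doubling_cover : exists2 C : code n, maximal_doubly_even C &
  forall x, row_mx (codeword h x) (codeword (fun j => h j + lab j) x) \in gen_doubling C.
Proof.
have [D0 [bD0 D0h]] := blockwise_cover.
have [D [/subvP D0D bD maxD]] := maximal_blockwise bD0.
have J8 v : v != 0 -> (8 %| #|J v|)%N.
  by move/(proj2 (bL v)); rewrite count_label.
have mD : maximal_doubly_even D.
  apply: (blockwise_maximal (i0 := 0)) bD maxD => v v0.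
  have := J8 v v0; have : (#|J v| <= 20)%N by rewrite (leq_trans (max_card _)) ?card_ord.
  by rewrite -/(J v) !inE; move: #|J v| => c; clear; lia.
exists D => // x; have /blockwiseP[dD rD] := bD.
have J1 v : v != 0 -> char_word (J v) \in D.
  move=> v0; have J4 : (4 %| #|J v|)%N by have := J8 v v0; move: #|_| => c; clear; lia.
  apply/maxD/blockwise_extend => // [c cD||v'].
  - have := dD _ (rD _ v cD); apply: contraTeq; rewrite F2_neq0 -F2_neq0 dot_eq0 negbK.
    by rewrite overlap_char; move: (wt _) => c'; clear; lia.
  - by rewrite /wt supp_char.
  have <- : res (J v) (char_word (J v)) = char_word (J v) by rewrite res_id ?supp_char.
  by rewrite res_block; case: eqP => [->|_]; [left|right].
pose w : word n := \row_j dot x (lab j).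
have wE v : res (J v) w = if dot x v == 1 then char_word (J v) else 0.
  apply/rowP=> j; case: ifP => xv; rewrite !mxE !inE; case: eqP => // -> //.
    by rewrite (eqP xv).
  by case: (F2P (dot x v)) xv => ->.
have wD : w \in D.
  rewrite -(sum_blocks lab w); apply: rpred_sum => v _; rewrite -/(J v) wE.
  by case: eqP => [xv|_]; rewrite ?mem0v // J1 //; apply: contra_eq_neq xv => ->; rewrite dot0r.
have wR : w \in RadC D.
  apply/(RadC_P dD wD); split=> [c cD|].
    rewrite overlapC (overlap_blocks lab); apply: dvdn_sum => v _; rewrite -/(J v) wE.
    case: ifP => _; first by rewrite overlap_char; apply/dD/rD.
    by rewrite /overlap (_ : supp 0 = set0) ?set0I ?cards0 //; apply/setP=> i; rewrite !inE mxE.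
  rewrite (wt_blocks lab); apply: dvdn_sum => v _; rewrite -/(J v) wE.
  case: eqP => [xv|_]; last by rewrite wt0.
  by rewrite /wt supp_char J8 //; apply: contra_eq_neq xv => ->; rewrite dot0r.
have aD : codeword h x \in D by apply: D0D.
have bE : codeword (fun j => h j + lab j) x = codeword h x + w.
  by apply/rowP=> j; rewrite !mxE dotDr.
have -> : row_mx (codeword h x) (codeword (fun j => h j + lab j) x) =
    row_mx w 0 + row_mx (codeword h x + w) (codeword h x + w).
  by rewrite bE add_row_mx add0r (addrC w) addwK.
apply: rpredD; apply: memv_span; rewrite mem_cat; apply/orP; [left|right].
  by apply/imageP; exists w; rewrite // inE wD.
by apply/imageP; exists (codeword h x + w); rewrite // rpredD.
Qed.

End Assembly.

Lemma wt_col_perm n (s : 'S_n) (x : word n) : wt (col_perm s x) = wt x.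
Proof.
rewrite /wt -(card_imset (supp (col_perm s x)) (@perm_inj _ s)); apply: eq_card => i.
apply/imsetP/idP => [[j + ->]|ix]; first by rewrite !inE mxE.
by exists ((s^-1)%g i); rewrite ?permKV //; move: ix; rewrite !inE mxE permKV.
Qed.

(** The preimage of [D] under the permutation is a triply even code containing
    [T]. *)
Lemma maximal_equiv n (T D : code n) (s : 'S_n) : maximal_triply_even T ->
  triply_even D -> (forall t, t \in T -> col_perm s t \in D) -> code_equiv T D.
Proof.
move=> [_ maxT] tD TD; exists s.
pose P (x : word n) := col_perm s x \in D.
have PP : sum_closed P.
  split=> [|x y]; rewrite /P; first by rewrite linear0 mem0v.
  by move=> Px Py; rewrite linearD rpredD.
have TE : code_of P = T.
  apply: maxT => [x|]; first by rewrite mem_code_of // => /tD; rewrite wt_col_perm.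
  by apply/subvP=> t /TD tP; rewrite mem_code_of.
apply/setP=> y; rewrite inE; apply/idP/imsetP => [yD|[x xT ->]]; last exact: TD.
exists (col_perm s^-1 y); last by rewrite -col_permM mulgV col_perm1.
by rewrite -TE mem_code_of // /P -col_permM mulgV col_perm1.
Qed.

Local Close Scope ring_scope.

Theorem theorem30 (n : nat) (hn : n \in [:: 4; 8; 12; 16; 20])
    (T : code (n + n)) (hT : maximal_triply_even T) :
  exists2 C : code n, maximal_doubly_even C & code_equiv T (gen_doubling C).
Proof.
have [k [col colP]] := code_columns T.
have dm : divisible 8 (column_mult col).
  by move=> x; rewrite -wt_codeword; apply: (proj1 hT); apply/colP; exists x.
have [L Lm bL] : paired (column_mult col).
  apply: divisible_paired => //; rewrite total_column_mult;
  by move: hn; rewrite !inE => /or4P[||| /orP[]] /eqP ->.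
have [s [szL sE]] := pairing_perm Lm.
have n20 : n <= 20 by move: hn; rewrite !inE => /or4P[||| /orP[]] /eqP ->.
have [C mC cover] := doubling_cover szL n20 bL.
exists C => //; apply: (maximal_equiv (s := s)) => //.
  exact: doubling_triply_even (proj1 mC).
move=> _ /colP[x ->].
by rewrite sE; apply: cover.
Qed.
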